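(* Let $Z:\mathcal P\to\mathbb R$ be $\mathcal C^2$, with $Z$ $L_0$-Lipschitz, its gradient $\nabla Z$ $L_1$-Lipschitz and its Hessian $\nabla^2Z$ $L_2$-Lipschitz (all with respect to $\|\cdot\|$). Let the noisy function evaluation be unbiased, $E[\hat Z(\mathbf p)]=Z(\mathbf p)$, with variance $\sigma^2(\mathbf p):=\mathrm{Var}[\hat Z(\mathbf p)]$ bounded by a constant $\sigma^2>0$. Let $c>0$, and choose a random probability vector $\boldsymbol\delta\in\mathcal P$ and $S(\mathbf p,\boldsymbol\delta)=\gamma(\boldsymbol\delta-\mathbf p)$, $\gamma\in\mathbb R$, that satisfy $$\text{(MC1)}\quad E[S(\mathbf p,\boldsymbol\delta)]=\mathbf 0,\qquad \text{(MC2)}\quad E[(\boldsymbol\delta-\mathbf p)S(\mathbf p,\boldsymbol\delta)']=\mathbf I-\lambda\mathbf 1\mathbf 1'\ \text{ for some }\lambda\in\mathbb R.$$ Let $$\hat\psi_{CFE}=\frac1R\sum_{j=1}^R\frac{\hat Z^{2j-1}((1-c)\mathbf p+c\boldsymbol\delta^j)-\hat Z^{2j}((1+c)\mathbf p-c\boldsymbol\delta^j)}{2c}S(\mathbf p,\boldsymbol\delta^j),\qquad \psi_{CFE}=E[\hat\psi_{CFE}].$$ Then the bias is given by $$\psi_{CFE}-\nabla Z(\mathbf p)-\epsilon_0\mathbf 1=\boldsymbol\epsilon,\qquad \epsilon_0=-\frac{\nabla Z(\mathbf p)'\mathbf 1}{n},\qquad \|\boldsymbol\epsilon\|=O(nc^2L_2),$$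 and the variance is given by $$E[\|\hat\psi_{CFE}-\psi_{CFE}\|^2]=O\Big(\frac{\gamma n}{Rc^2}\,[\sigma^2+c^2M_1^2+c^4L_1^2]\Big).$$
   Context: $\mathcal P=\{\mathbf p\in\mathbb R^n: \sum_i p_i=1,\ p_i\ge 0\}$ is the probability simplex and $\mathbf p\in\mathcal P$ is the point at which the gradient is estimated. $\|\cdot\|$ is the Euclidean norm of vectors and the spectral norm of matrices, $\mathbf 1$ is the all-ones vector, $\mathbf I$ the identity matrix, $\mathbf e_i$ the $i$-th standard basis vector, and $'$ denotes transpose. Derivatives on the simplex: the gradient of $Z$ at $\mathbf p\in\mathcal P$ is a vector with $Z(\mathbf q)-Z(\mathbf p)=\nabla Z(\mathbf p)'(\mathbf q-\mathbf p)+o(\|\mathbf q-\mathbf p\|)$ for $\mathbf q\in\mathcal P$; this determines it only up to adding multiples of $\mathbf 1$, and in the theorem $\nabla Z(\mathbf p)=(Z_1(\mathbf p),\dots,Z_n(\mathbf p))'$ is the unique version $Z_i(\mathbf p)=\lim_{\epsilon\to0_+}\frac{Z((1-\epsilon)\mathbf p+\epsilon\mathbf e_i)-Z(\mathbf p)}{\epsilon}$. Higher-order derivatives are defined recursively by $Z_{i_1,\dots,i_k,i_{k+1}}(\mathbf p)=\lim_{\epsilon\to0_+}\frac{Z_{i_1,\dots,i_k}((1-\epsilon)\mathbf p+\epsilon\mathbf e_{i_{k+1}})-Z_{i_1,\dots,i_k}(\mathbf p)}{\epsilon}$, and $\nabla^2Z=(Z_{i,j})_{i,j}$. $M_1=\sup_{\mathbf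 p\in\mathcal P}\|\nabla Z(\mathbf p)\|$, which is finite since $\nabla Z$ is Lipschitz and $\mathcal P$ is bounded. $R$ is the number of replications; $\boldsymbol\delta^1,\dots,\boldsymbol\delta^R$ are independent draws of $\boldsymbol\delta$, and $\hat Z^1(\cdot),\dots,\hat Z^{2R}(\cdot)$ are independent function evaluations, independent of the $\boldsymbol\delta^j$. $O(X)$ means bounded by an absolute constant times $X$. *)

(* Defs.v *)
(* MathComp / MathComp-Analysis *)
From mathcomp Require Export all_boot all_order all_algebra.
From mathcomp Require Export all_classical all_reals all_analysis.
Export Order.TTheory GRing.Theory Num.Theory numFieldNormedType.Exports.

Set Implicit Arguments.
Unset Strict Implicit.
Unset Printing Implicit Defensive.

Local Open Scope classical_set_scope.
Local Open Scope ring_scope.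

Section Simplex.
Context {R : realType} {n : nat}.
Implicit Types (u v p q g : 'cV[R]_n) (f : 'cV[R]_n -> R).

Definition dotv u v : R := (u^T *m v) 0 0.

(* The library norm `|v| on matrices is the sup norm, hence this one. *)
Definition enorm v : R := Num.sqrt (\sum_i v i 0 ^+ 2).

Definition spectral_norm (A : 'M[R]_n) : R :=
  sup [set enorm (A *m v) | v in [set v | enorm v <= 1]].

Definition ones : 'cV[R]_n := const_mx 1.

Definition simplex : set 'cV[R]_n :=
  [set p | \sum_i p i 0 = 1 /\ forall i, 0 <= p i 0].

(* Functions on the simplex are functions on R^n whose values outside the
   simplex are never used: (1 - e) p + e e_i stays in the simplex for small
   e > 0, and all other conditions below are relative to it. *)
Definition simplex_gradient f p g : Prop :=
  (fun q => f q - f p - dotv g (q - p) : R^o)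
    =o_ (within simplex (nbhs p)) (fun q => enorm (q - p) : R^o).

(* Junk if the one-sided limit does not exist; it does as soon as f has some
   simplex_gradient at p. *)
Definition simplex_partial (i : 'I_n) f p : R :=
  lim ((f ((1 - e) *: p + e *: delta_mx i 0) - f p) / e @[e --> 0^'+]).

Definition grad f p : 'cV[R]_n := \col_i simplex_partial i f p.

Definition hess f p : 'M[R]_n :=
  \matrix_(i, j) simplex_partial j (simplex_partial i f) p.

Definition simplex_C1 f : Prop :=
  (forall p, simplex p -> exists g, simplex_gradient f p g) /\
  (forall i, {within simplex, continuous (simplex_partial i f)}).

Definition simplex_C2 f : Prop :=
  simplex_C1 f /\ forall i, simplex_C1 (simplex_partial i f).

Definition simplex_lipschitz {V : zmodType} (nrm : V -> R)
    (F : 'cV[R]_n -> V) (L : R) : Prop :=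
  forall p q, simplex p -> simplex q -> nrm (F p - F q) <= L * enorm (p - q).

End Simplex.
Arguments ones {R n}.

(* R^n with its Borel sigma-algebra (the library does not equip matrices with
   one) *)
Notation borel_cV R n := (g_sigma_algebraType (@open 'cV[R]_n)).

Section Probability.
Context {d : measure_display} {Omega : measurableType d} {R : realType}.
Variable P : probability Omega R.

Definition expectation_mx {m n : nat} (X : Omega -> 'M[R]_(m, n)) :
  'M[R]_(m, n) := \matrix_(i, j) fine ('E_P[fun w => X w i j])%E.

Definition same_law {d'} {T : measurableType d'} (X Y : {RV P >-> T}) : Prop :=
  forall A, measurable A -> distribution P X A = distribution P Y A.

Definition mutually_independent {I : finType} (G : I -> set (set Omega)) :
    Prop :=
  forall (J : {set I}) (A : I -> set Omega), (forall i, i \in J -> G i (A i)) ->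
    (P (\bigcap_(i in [set i | i \in J]) A i) = \prod_(i in J) P (A i))%E.

Definition sigma_RV {d'} {T : measurableType d'} (X : {RV P >-> T}) :
    set (set Omega) :=
  preimage_set_system setT X measurable.

End Probability.

(* Evaluations number 2j-1 and 2j (j = 1, ..., N), with indices shifted to start
   from 0 *)
Lemma fst_eval_subproof N (j : 'I_N) : (2 * j < 2 * N)%N.
Proof. by rewrite ltn_pmul2l. Qed.
Definition fst_eval N (j : 'I_N) : 'I_(2 * N) := Ordinal (fst_eval_subproof j).

Lemma snd_eval_subproof N (j : 'I_N) : ((2 * j).+1 < 2 * N)%N.
Proof. by rewrite !mul2n ltn_Sdouble. Qed.
Definition snd_eval N (j : 'I_N) : 'I_(2 * N) := Ordinal (snd_eval_subproof j).

Section Estimator.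
Context {R : realType} {n : nat}.

Definition perturbation (gamma : R) (p delta : 'cV[R]_n) : 'cV[R]_n :=
  gamma *: (delta - p).

Definition plus_point (c : R) (p delta : 'cV[R]_n) : 'cV[R]_n :=
  (1 - c) *: p + c *: delta.

Definition minus_point (c : R) (p delta : 'cV[R]_n) : 'cV[R]_n :=
  (1 + c) *: p - c *: delta.

(* Zhat k w is the (k+1)-st random function evaluation at outcome w. It is used
   with Zhat k w = zeta (xis k w), where the seeds xis k are random elements and
   zeta : seed -> R^n -> R is jointly measurable: independence of the values
   of Zhat k at fixed points alone would not control its value at a random
   point. *)
Definition psi_hat {Omega : Type} {N : nat} (c gamma : R) (p : 'cV[R]_n)
    (delta : 'I_N -> Omega -> 'cV[R]_n)
    (Zhat : 'I_(2 * N) -> Omega -> 'cV[R]_n -> R) (w : Omega) : 'cV[R]_n :=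
  N%:R^-1 *: \sum_(j < N)
    (((Zhat (fst_eval j) w (plus_point c p (delta j w))
       - Zhat (snd_eval j) w (minus_point c p (delta j w))) / (2 * c))
     *: perturbation gamma p (delta j w)).

End Estimator.

(* Main.v *)
From HB Require Import structures.
Require Import Defs.
From mathcomp Require Import ring lra measurable_realfun.
Set Implicit Arguments.
Unset Strict Implicit.
Unset Printing Implicit Defensive.
Local Open Scope classical_set_scope.
Local Open Scope ring_scope.

(* Write Delta = delta - p.  As the coordinates of Delta sum to 0, (MC2) forces
   lambda = 1/n, and its trace gives gamma E|Delta|^2 = n - 1.  Along the segment
   from p - c Delta to p + c Delta, a second-order Taylor estimate with Lipschitz
   Hessian has its even terms cancel:
   Z(p + c Delta) - Z(p - c Delta) = 2 c grad Z(p)'Delta + O(L2 c^3 |Delta|^3).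
   Averaged against gamma Delta / (2 c), the linear term becomes
   (I - 11'/n) grad Z(p), and since |Delta|^2 <= 2 the remainder is
   O(gamma E|Delta|^4 c^2 L2) = O(n c^2 L2).

   For the variance, the N summands are functions of disjoint blocks of
   independent variables, hence uncorrelated.  Given delta, the noise of an
   evaluation at a random point is centered with second moment at most sigma^2
   (Fubini for the law of (delta, xi), a product), and the noiseless difference is
   at most 2 c M1 |Delta| in absolute value, so one summand has second moment
   O((gamma^2 / c^2) (sigma^2 + c^2 M1^2) E|Delta|^2). *)

(** * Calculus on the simplex *)

Section EuclideanNorm.
Context {R : realType} {n : nat}.
Implicit Types u v p q g : 'cV[R]_n.

(** The gradient of [Z] exists only relative to the simplex, up to multiples of 1, and its chosen
    version is made of one-sided limits. Both obstacles vanish along a segment that stays in the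
    simplex: its direction has coordinate sum 0, so all versions agree on it, and at its inner
    points the derivative is two-sided. All calculus is therefore one-dimensional, by the mean value
    theorem; end points may lie on the boundary and contribute only continuity. With no third
    derivative at hand, the Taylor estimate comes from two mean value steps applied to the odd
    function t -> Z(p + t u) - Z(p - t u), whose second derivative is a difference of Hessians. The
    bias vector e is bounded by testing it against itself, e'e <= C |e|; bounding its coordinates
    one by one would cost a further power of n. In the variance, gamma^2 E|Delta|^2 is read as
    |gamma| times |gamma| E|Delta|^2 <= n: hence the single power of [gamma] and the factor n. *)

Lemma dotvE u v : dotv u v = \sum_i u i 0 * v i 0.
Proof. by rewrite /dotv mxE; apply: eq_bigr => i _; rewrite mxE. Qed.

Lemma dotvC u v : dotv u v = dotv v u.
Proof. by rewrite !dotvE; apply: eq_bigr => i _; rewrite mulrC. Qed.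

Lemma dotvBl u v g : dotv (u - v) g = dotv u g - dotv v g.
Proof. by rewrite !dotvE -sumrB; apply: eq_bigr => i _; rewrite !mxE mulrBl. Qed.

Lemma dotvBr u v g : dotv g (u - v) = dotv g u - dotv g v.
Proof. by rewrite !dotvE -sumrB; apply: eq_bigr => i _; rewrite !mxE mulrBr. Qed.

Lemma dotvDr u v g : dotv g (u + v) = dotv g u + dotv g v.
Proof. by rewrite !dotvE -big_split; apply: eq_bigr => i _; rewrite !mxE mulrDr. Qed.

Lemma dotvZr a u v : dotv u (a *: v) = a * dotv u v.
Proof.
rewrite !dotvE mulr_sumr; apply: eq_bigr => i _; rewrite !mxE; ring.
Qed.

Lemma dotvZl a u v : dotv (a *: u) v = a * dotv u v.
Proof. by rewrite dotvC dotvZr dotvC. Qed.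

Lemma dotvNr u v : dotv u (- v) = - dotv u v.
Proof. by rewrite -scaleN1r dotvZr mulN1r. Qed.

Lemma dotvNl u v : dotv (- u) v = - dotv u v.
Proof. by rewrite dotvC dotvNr dotvC. Qed.

Lemma enorm_ge0 v : 0 <= enorm v.
Proof. exact: sqrtr_ge0. Qed.

Lemma sqr_enorm v : enorm v ^+ 2 = \sum_i v i 0 ^+ 2.
Proof. by rewrite sqr_sqrtr// sumr_ge0// => i _; rewrite sqr_ge0. Qed.

Lemma sqr_enorm_dotv v : enorm v ^+ 2 = dotv v v.
Proof. by rewrite sqr_enorm dotvE; apply: eq_bigr => i _; rewrite expr2. Qed.

Lemma enormZ a v : enorm (a *: v) = `|a| * enorm v.
Proof.
apply: (@pexpIrn _ 2) => //; rewrite ?nnegrE ?mulr_ge0 ?enorm_ge0//.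
rewrite exprMn !sqr_enorm mulr_sumr real_normK ?num_real//.
by apply: eq_bigr => i _; rewrite mxE exprMn.
Qed.

Lemma enorm0 : enorm (0 : 'cV[R]_n) = 0.
Proof. by rewrite -(scale0r (0 : 'cV_n)) enormZ normr0 mul0r. Qed.

Lemma enormN v : enorm (- v) = enorm v.
Proof. by rewrite -scaleN1r enormZ normrN1 mul1r. Qed.

Lemma coord_le_enorm v i : `|v i 0| <= enorm v.
Proof.
rewrite -(@ler_pXn2r _ 2) ?nnegrE ?enorm_ge0// real_normK ?num_real// sqr_enorm.
by rewrite (bigD1 i)//= lerDl sumr_ge0// => k _; rewrite sqr_ge0.
Qed.

Lemma enorm_eq0 v : enorm v = 0 -> v = 0.
Proof.
move=> v0; apply/matrixP => i j; rewrite ord1 mxE.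
by apply/eqP; rewrite -normr_le0 -v0 coord_le_enorm.
Qed.

Lemma dotv_le u v : dotv u v <= enorm u * enorm v.
Proof.
have [/eqP/enorm_eq0 ->|u0] := boolP (enorm u == 0).
  by rewrite enorm0 mul0r dotvE big1// => i _; rewrite mxE mul0r.
have [/eqP/enorm_eq0 ->|v0] := boolP (enorm v == 0).
  by rewrite enorm0 mulr0 dotvE big1// => i _; rewrite mxE mulr0.
have uv_gt0 : 0 < enorm u * enorm v by rewrite mulr_gt0// lt0r ?u0 ?v0 enorm_ge0.
(* This square expands to 2|u||v|(|u||v| - u'v), so the sign of the last factor is that of a
   square. *)
have : 0 <= enorm (enorm v *: u - enorm u *: v) ^+ 2 by rewrite sqr_ge0.
have -> : enorm (enorm v *: u - enorm u *: v) ^+ 2 =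
    2 * (enorm u * enorm v) * (enorm u * enorm v - dotv u v).
  rewrite sqr_enorm_dotv dotvBr !dotvZr !dotvBl.
  by rewrite !dotvZl (dotvC v u) -!sqr_enorm_dotv; ring.
by rewrite pmulr_rge0 ?subr_ge0// mulr_gt0.
Qed.

Lemma normr_dotv_le u v : `|dotv u v| <= enorm u * enorm v.
Proof.
rewrite ler_norml dotv_le andbT lerNl -[- dotv u v]mulN1r -dotvZr.
by apply: (le_trans (dotv_le _ _)); rewrite enormZ normrN1 mul1r.
Qed.

Lemma enormD u v : enorm (u + v) <= enorm u + enorm v.
Proof.
have [->|] := eqVneq (enorm (u + v)) 0; first by rewrite addr_ge0 ?enorm_ge0.
move=> n0; have npos : 0 < enorm (u + v) by rewrite lt0r n0 enorm_ge0.
rewrite -(ler_pM2l npos) -expr2 sqr_enorm_dotv mulrDr dotvDr.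
by rewrite lerD ?dotv_le.
Qed.

(** [sup] is meaningful only for a set bounded above. The Frobenius norm [B] bounds it, by
    Cauchy-Schwarz on each row; the estimate then follows by normalizing [v]. *)
Lemma enorm_mulmx_le (A : 'M[R]_n) v : enorm (A *m v) <= spectral_norm A * enorm v.
Proof.
pose B := Num.sqrt (\sum_i enorm (row i A)^T ^+ 2).
have AB w : enorm w <= 1 -> enorm (A *m w) <= B.
  move=> w1; rewrite ler_sqrt; last by rewrite sumr_ge0// => i _; rewrite sqr_ge0.
  apply: ler_sum => i _.
  have -> : (A *m w) i 0 = dotv (row i A)^T w.
    by rewrite mxE dotvE; apply: eq_bigr => j _; rewrite !mxE.
  rewrite -real_normK ?num_real// ler_pXn2r ?nnegrE ?enorm_ge0//.
  by apply: (le_trans (normr_dotv_le _ _)); rewrite ler_piMr ?enorm_ge0.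
have Asup : has_sup [set enorm (A *m w) | w in [set w | enorm w <= 1]].
  split; first by exists (enorm (A *m 0)), 0 => //=; rewrite enorm0 ler01.
  by exists B => _ [w w1 <-]; exact: AB.
have [/eqP/enorm_eq0 ->|v0] := boolP (enorm v == 0).
  by rewrite mulmx0 enorm0 mulr0.
have vpos : 0 < enorm v by rewrite lt0r v0 enorm_ge0.
rewrite -ler_pdivrMr// mulrC -[X in X * _]ger0_norm ?invr_ge0 ?enorm_ge0//.
rewrite -enormZ scalemxAr; apply: (ub_le_sup Asup.2).
exists ((enorm v)^-1 *: v) => //=.
by rewrite enormZ ger0_norm ?invr_ge0 ?enorm_ge0// mulVf.
Qed.

Lemma simplex_convex p q t : simplex p -> simplex q -> 0 <= t <= 1 ->
  simplex ((1 - t) *: p + t *: q).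
Proof.
move=> [p1 p0] [q1 q0] /andP[t0 t1]; split=> [|i].
  under eq_bigr do rewrite !mxE; rewrite big_split/= -!mulr_sumr p1 q1; ring.
by rewrite !mxE addr_ge0// mulr_ge0// subr_ge0.
Qed.

Lemma simplex_delta i : simplex (delta_mx i 0 : 'cV[R]_n).
Proof.
split=> [|j]; last by rewrite mxE ler0n.
rewrite (bigD1 i)//= mxE !eqxx big1 ?addr0// => j ji.
by rewrite mxE (negPf ji).
Qed.

Lemma simplex_sub_sum p q : simplex p -> simplex q -> \sum_i (p - q) i 0 = 0.
Proof.
by move=> [p1 _] [q1 _]; under eq_bigr do rewrite !mxE; rewrite sumrB p1 q1 subrr.
Qed.

Lemma simplex_coord_le1 p i : simplex p -> p i 0 <= 1.
Proof. by move=> [<- p0]; rewrite (bigD1 i)//= lerDl sumr_ge0. Qed.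

(** For a, b in [0, 1] one has (a - b)^2 <= a + b, and the coordinates of each point sum to 1. *)
Lemma simplex_sqr_dist_le2 p q : simplex p -> simplex q -> enorm (p - q) ^+ 2 <= 2.
Proof.
move=> sp sq; rewrite sqr_enorm.
apply: (@le_trans _ _ (\sum_i (p i 0 + q i 0))); last first.
  by rewrite big_split/= sp.1 sq.1.
apply: ler_sum => i _; rewrite !mxE.
have := simplex_coord_le1 i sp; have := simplex_coord_le1 i sq.
have := sp.2 i; have := sq.2 i; nra.
Qed.

End EuclideanNorm.

(** * Derivatives along segments of the simplex *)

Section SimplexDerivative.
Context {R : realType} {n : nat}.
Implicit Types (u v p q g : 'cV[R]_n) (f Z : 'cV[R]_n -> R).

Lemma cvg_addZ0 p u : p + e *: u @[e --> (0 : R)] --> p.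
Proof.
suff: p + e *: u @[e --> (0 : R)] --> p + 0 *: u by rewrite scale0r addr0.
by apply: cvgD; [exact: cvg_cst|apply: cvgZr_tmp; exact: cvg_id].
Qed.

(** The filter is left open in order to serve twice: right neighborhoods of 0 give the one-sided
    partial derivatives, punctured neighborhoods give two-sided derivatives along a line. *)
Lemma simplex_gradient_dir f p g u (F : set_system R) {FF : Filter F} :
  simplex_gradient f p g -> F `=>` 0^' ->
  (\forall e \near F, simplex (p + e *: u)) ->
  (f (p + e *: u) - f p) / e @[e --> F] --> dotv g u.
Proof.
move=> fg F0 sF; apply/cvgrPdist_le => eps eps0.
(* Adding 1 keeps the denominator positive when [u] is 0. *)
have /eqoP/(_ (eps / (enorm u + 1))) := fg.
have u1 : 0 < enorm u + 1 by rewrite ltr_wpDl ?enorm_ge0.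
rewrite divr_gt0// => /(_ isT); rewrite near_withinE => H.
have {}H : \forall e \near F, simplex (p + e *: u) ->
  `|f (p + e *: u) - f p - dotv g ((p + e *: u) - p)| <=
  eps / (enorm u + 1) * `|enorm ((p + e *: u) - p)|.
  apply: F0; apply: nbhs_dnbhs. exact: (@cvg_addZ0 p u _ H).
  have Fn0 : \forall e \near F, e != 0.
  by apply: F0; exact: (@nbhs_dnbhs_neq R 0).
near=> e.
have e0 : e != 0 by near: e.
have se : simplex (p + e *: u) by near: e.
have : simplex (p + e *: u) -> `|f (p + e *: u) - f p - dotv g ((p + e *: u) - p)| <=
  eps / (enorm u + 1) * `|enorm ((p + e *: u) - p)| by near: e.
move=> /(_ se); rewrite [p + _ - p]addrC addKr dotvZr enormZ => H'.
have -> : dotv g u - (f (p + e *: u) - f p) / e =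
   - ((f (p + e *: u) - f p - e * dotv g u) / e) by field.
rewrite normrN normrM normfV ler_pdivrMr ?normr_gt0//.
apply: (le_trans H').
rewrite normrM normr_id (ger0_norm (enorm_ge0 _)).
have -> : eps / (enorm u + 1) * (`|e| * enorm u) =
  eps * `|e| * (enorm u / (enorm u + 1)) by ring.
by rewrite ler_piMr ?mulr_ge0 ?(ltW eps0)// ler_pdivrMr// mul1r lerDl.
Unshelve. all: by end_near. Qed.

(** The difference quotient runs in the direction e_i - p. Hence [grad f p] is g - (g'p) 1,
    whichever representative g of the gradient is given. *)
Lemma simplex_partialE i f p g : simplex p -> simplex_gradient f p g ->
  simplex_partial i f p = dotv g (delta_mx i 0 - p).
Proof.
move=> sp fg; rewrite /simplex_partial; apply: cvg_lim => //.
have segE e : (1 - e) *: p + e *: delta_mx i 0 = p + e *: (delta_mx i 0 - p).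
  by rewrite scalerBl scale1r scalerBr -!addrA (addrC (- _)).
under eq_fun do rewrite segE.
apply: (simplex_gradient_dir fg).
  move=> A [e /= e0 eA]; exists e => //= t te t0; apply: eA => //.
  by rewrite gt_eqF.
near=> e; rewrite -segE; apply: simplex_convex => //; first exact: simplex_delta.
apply/andP; split; first by near: e; exact: nbhs_right_ge.
by near: e; exact: nbhs_right_le.
Unshelve. all: by end_near. Qed.

Lemma is_derive_line f p g u (t : R) : simplex_gradient f (p + t *: u) g ->
  (\forall s \near t, simplex (p + s *: u)) ->
  is_derive t 1 (fun s => f (p + s *: u)) (dotv g u).
Proof.
move=> fg ts.
have shiftE h : p + (h + t) *: u = (p + t *: u) + h *: u.
  by rewrite scalerDl addrA addrAC.
have sF : \forall e \near (0 : R)^', simplex ((p + t *: u) + e *: u).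
  move/nbhs_ballP: ts => [e /= e0 te]; apply: nbhs_dnbhs; apply/nbhs_ballP.
  exists e => // h; rewrite -ball_normE/= sub0r normrN => he.
  rewrite -shiftE; apply: te; rewrite -ball_normE/=.
  by rewrite opprD addrCA subrr addr0 normrN.
have H : (f ((p + t *: u) + e *: u) - f (p + t *: u)) / e @[e --> (0 : R)^'] --> dotv g u.
  exact: (simplex_gradient_dir fg (fun A H => H) sF).
have E : (fun h : R => h^-1 *: (((fun s => f (p + s *: u)) \o shift t) (h *: 1) -
    f (p + t *: u))) = (fun e => (f ((p + t *: u) + e *: u) - f (p + t *: u)) / e).
  apply/funext => h /=; rewrite -shiftE mulrC; congr (_ * (f (p + (_ + _) *: u) - _)).
  exact: mulr1.
apply: DeriveDef; rewrite /derivable/derive E; first exact: cvgP H.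
exact: cvg_lim H.
Qed.

Definition differentiable_on_simplex f :=
  forall q, simplex q -> exists g, simplex_gradient f q g.

(** The shift by a multiple of 1 that separates [grad f p] from [g] is orthogonal to every [u] with
    coordinate sum 0. *)
Lemma dotv_grad f p g u : simplex p -> simplex_gradient f p g ->
  \sum_i u i 0 = 0 -> dotv (grad f p) u = dotv g u.
Proof.
move=> sp fg u0; rewrite dotvE.
under eq_bigr do rewrite mxE (simplex_partialE _ sp fg) dotvBr mulrBl.
rewrite sumrB -mulr_sumr u0 mulr0 subr0 dotvE; apply: eq_bigr => i _.
rewrite dotvE (bigD1 i)//= mxE !eqxx mulr1 big1 ?addr0// => k ki.
by rewrite mxE (negPf ki) mulr0.
Qed.

Lemma simplex_line p u t : simplex (p + u) -> simplex (p - u) -> -1 <= t <= 1 ->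
  simplex (p + t *: u).
Proof.
move=> spu smu /andP[t0 t1].
have -> : p + t *: u = (1 - (1 + t) / 2) *: (p - u) + ((1 + t) / 2) *: (p + u).
  by apply/matrixP => i j; rewrite !mxE; field.
by apply: simplex_convex => //; apply/andP; split; lra.
Qed.

Lemma simplex_line_sum p u : simplex (p + u) -> simplex (p - u) ->
  \sum_i u i 0 = 0.
Proof.
move=> spu smu; have := simplex_sub_sum spu smu.
rewrite (_ : p + u - (p - u) = 2 *: u); last first.
  by apply/matrixP => i j; rewrite !mxE; ring.
under eq_bigr do rewrite mxE; rewrite -mulr_sumr => /eqP.
by rewrite mulf_eq0 pnatr_eq0 => /eqP.
Qed.

(** Restricted to the open interval, where a whole neighborhood of [t] stays on the segment. At the
    ends, continuity from the Lipschitz bound is what the mean value theorem asks for. *)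
Lemma is_derive_simplex_line f p u (t : R) : differentiable_on_simplex f ->
  simplex (p + u) -> simplex (p - u) -> -1 < t < 1 ->
  is_derive t 1 (fun s => f (p + s *: u)) (dotv (grad f (p + t *: u)) u).
Proof.
move=> df spu smu t1.
have st : simplex (p + t *: u).
  by apply: simplex_line => //; case/andP: t1 => /ltW -> /ltW ->.
have [g fg] := df _ st.
rewrite (dotv_grad st fg (simplex_line_sum spu smu)); apply: is_derive_line => //.
near=> s; apply: simplex_line => //.
have : s \in `]-1, 1[ by near: s; apply: near_in_itvoo; rewrite in_itv.
by rewrite in_itv/= => /andP[/ltW -> /ltW ->].
Unshelve. all: by end_near. Qed.

Lemma lipschitz_within_continuous (A : set R) (f : R -> R) (L : R) :
  (forall s t, A s -> A t -> `|f s - f t| <= L * `|s - t|) ->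
  {within A, continuous f}.
Proof.
move=> fL; apply/subspace_continuousP => x Ax.
apply/cvgrPdist_le => e e0.
have L1 : 0 < `|L| + 1 by rewrite ltr_wpDl.
have d0 : 0 < (`|L| + 1)^-1 * e by rewrite mulr_gt0// invr_gt0.
rewrite near_withinE; near=> y => Ay.
apply: (le_trans (fL _ _ Ax Ay)).
apply: (@le_trans _ _ ((`|L| + 1) * `|x - y|)).
  by rewrite ler_wpM2r// (le_trans (ler_norm _))// lerDl.
rewrite -ler_pdivlMl// ltW//; near: y.
Unshelve. all: by end_near. Qed.

Lemma continuous_simplex_line f p u L : simplex_lipschitz Num.norm f L ->
  simplex (p + u) -> simplex (p - u) ->
  {within `[-1, 1], continuous (fun s : R => f (p + s *: u))}.
Proof.
move=> fL spu smu; apply: (@lipschitz_within_continuous _ _ (L * enorm u)) => s t.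
rewrite /= !in_itv/= => s1 t1.
apply: (le_trans (fL _ _ (simplex_line spu smu s1) (simplex_line spu smu t1))).
by rewrite opprD addrACA subrr add0r -scalerBl enormZ -mulrA [`|_| * _]mulrC.
Qed.

(** The constant is the gradient bound [M], which becomes M1 in the variance; [L] serves for
    continuity up to the ends of the segment. *)
Lemma sym_diff_le f p u L M : simplex_lipschitz Num.norm f L ->
  differentiable_on_simplex f -> simplex (p + u) -> simplex (p - u) ->
  (forall q, simplex q -> enorm (grad f q) <= M) ->
  `|f (p + u) - f (p - u)| <= 2 * M * enorm u.
Proof.
move=> fL df spu smu fM.
have [t t1] := @MVT R (fun s => f (p + s *: u)) (fun t => dotv (grad f (p + t *: u)) u)
  (-1) 1 ltac:(lra)
  (fun t t1 => is_derive_simplex_line df spu smu t1) (continuous_simplex_line fL spu smu).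
rewrite scale1r scaleN1r => ->; rewrite normrM.
have -> : `|1 - -1| = 2 :> R by rewrite ger0_norm; lra.
rewrite mulrC -mulrA ler_pM2l// (le_trans (normr_dotv_le _ _))// ler_wpM2r ?enorm_ge0//.
by apply/fM/simplex_line => //; move: t1; rewrite in_itv/= => /andP[/ltW -> /ltW ->].
Qed.

(** Let D(t) = f(p + t u) - f(p - t u), so D(0) = 0 and D'(0) = 2 grad f(p)'u. Two mean value steps
    give D(1) = D'(s) = D'(0) + s D''(t) with 0 < t < s < 1. Here D''(t) = u'(H(p + t u) - H(p - t
    u))u, at points 2t|u| apart, so |D''(t)| <= 2 |L2| |u|^3. The absolute value on [L2] covers a
    one-point simplex, where a negative Lipschitz constant is possible. *)
Lemma sym_diff_taylor f p u L L2 : simplex_C2 f -> simplex_lipschitz Num.norm f L ->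
  simplex_lipschitz spectral_norm (hess f) L2 -> simplex (p + u) -> simplex (p - u) ->
  `|f (p + u) - f (p - u) - 2 * dotv (grad f p) u| <= 2 * `|L2| * enorm u ^+ 3.
Proof.
move=> [[df _] d2f] fL hL spu smu.
have spNu : simplex (p + - u) by [].
have smNu : simplex (p - - u) by rewrite opprK.
have u0 := simplex_line_sum spu smu.
have fline (t : R) v : (v = u \/ v = - u) -> t \in `]-1, 1[ ->
    is_derive t 1 (fun s => f (p + s *: v)) (dotv (grad f (p + t *: v)) v).
  by rewrite in_itv/= => -[->|->] t1; exact: is_derive_simplex_line.
pose g1 v (t : R) := dotv (grad f (p + t *: v)) v.
pose g2 v (t : R) := dotv v (hess f (p + t *: v) *m v).
have gline (t : R) v : (v = u \/ v = - u) -> t \in `]-1, 1[ -> is_derive t 1 (g1 v) (g2 v t).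
  rewrite in_itv/= => vu t1.
  (* The weights [v i 0] are constant along the line, and the gradient of the i-th partial
     derivative is the i-th row of [hess]. *)
  have -> : g1 v = \sum_i (v i 0 *: (fun s : R => simplex_partial i f (p + s *: v))).
    apply/funext => s; rewrite /g1 dotvE fct_sumE; apply: eq_bigr => i _.
    by rewrite mxE mulrC.
  have -> : g2 v t = \sum_i (v i 0 *: dotv (grad (simplex_partial i f) (p + t *: v)) v).
    rewrite /g2 dotvE; apply: eq_bigr => i _; congr (_ * _).
    by rewrite mxE dotvE; apply: eq_bigr => j _; rewrite !mxE.
  apply: is_derive_sum => i; apply: is_deriveZ.
  by case: vu => ->; apply: is_derive_simplex_line => //; exact: (d2f i).1.
have g1N (t : R) : g1 (- u) t = - dotv (grad f (p - t *: u)) u.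
  by rewrite /g1 scalerN dotvNr.
have g2N (t : R) : g2 (- u) t = dotv u (hess f (p - t *: u) *m u).
  by rewrite /g2 scalerN mulmxN dotvNr dotvNl opprK.
have sub01 (t : R) : t \in `]0, 1[ -> t \in `]-1, 1[.
  by rewrite !in_itv/= => /andP[t0 ->]; rewrite andbT; lra.
pose D (t : R) := f (p + t *: u) - f (p + t *: - u).
have cD : {within `[0, 1], continuous D}.
  have sub : `[0, 1]%classic `<=` `[-1, 1 : R]%classic.
    by move=> t /=; rewrite !in_itv/= => /andP[t0 ->]; rewrite andbT; lra.
  by move=> x; apply: cvgB; apply: (continuous_subspaceW sub);
    exact: continuous_simplex_line fL _ _.
have dD (t : R) : t \in `]0, 1[ -> is_derive t 1 D (g1 u t - g1 (- u) t).
  by move=> /sub01 t1; apply: is_deriveB; apply: fline => //; [left|right].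
have [s s1] := MVT ltr01 dD cD.
rewrite subr0 mulr1 /D !scale1r !scale0r !addr0 subrr subr0 => ->.
pose E (t : R) := g1 u t - g1 (- u) t.
have s01 : 0 < s < 1 by move: s1; rewrite in_itv.
have in1 (t : R) : t \in `[0, s] -> t \in `]-1, 1[.
  by rewrite !in_itv/= => /andP[t0 ts]; apply/andP; split; lra.
have dE (t : R) : t \in `[0, s] -> is_derive t 1 E (g2 u t - g2 (- u) t).
  by move=> /in1 t1; apply: is_deriveB; apply: gline => //; [left|right].
have cE : {within `[0, s], continuous E}.
  by apply: derivable_within_continuous => t /dE [].
have [t t1] := MVT (andP s01).1
  (fun t (t1 : t \in `]0, s[) => dE t (subset_itv_oo_cc t1)) cE.
have -> : E 0 = 2 * dotv (grad f p) u.
  by rewrite /E g1N /g1 scale0r addr0 subr0; ring.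
rewrite /E => ->; rewrite g2N /g2 -dotvBr -mulmxBl subr0 normrM.
have {}t1 : 0 < t < s by move: t1; rewrite in_itv.
have st v : (v = u \/ v = - u) -> simplex (p + t *: v).
  by move=> [->|->]; apply: simplex_line => //; apply/andP; split; lra.
have su := enorm_ge0 u.
have tu := hL _ _ (st u (or_introl erefl)) (st (- u) (or_intror erefl)).
rewrite scalerN in tu.
have {}tu : spectral_norm (hess f (p + t *: u) - hess f (p - t *: u)) <= 2 * `|L2| * enorm u.
  apply: (le_trans tu).
  have -> : p + t *: u - (p - t *: u) = (2 * t) *: u.
    by apply/matrixP => i j; rewrite !mxE; ring.
  rewrite enormZ ger0_norm ?mulrA; last lra.
  rewrite ler_wpM2r//; have := ler_norm L2; have := normr_ge0 L2; nra.
have h1 : `|dotv u ((hess f (p + t *: u) - hess f (p - t *: u)) *m u)| <=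
    2 * `|L2| * enorm u ^+ 3.
  apply: (le_trans (normr_dotv_le _ _)).
  rewrite (_ : 2 * `|L2| * enorm u ^+ 3 = enorm u * (2 * `|L2| * enorm u * enorm u)); last by ring.
  rewrite ler_wpM2l// (le_trans (enorm_mulmx_le _ _))// ler_wpM2r//.
apply: (@le_trans _ _ (2 * `|L2| * enorm u ^+ 3 * 1)); last by rewrite mulr1.
by rewrite ler_pM// ger0_norm; lra.
Qed.

End SimplexDerivative.

(** * Independence of generated sigma-algebras *)

Section Independence.
Context {d : measure_display} {Omega : measurableType d} {R : realType}.
Variable P : probability Omega R.

Definition indep_sets (G H : set (set Omega)) : Prop :=
  forall A B, G A -> H B -> (P (A `&` B) = P A * P B)%E.

Lemma indep_setsC G H : indep_sets G H -> indep_sets H G.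
Proof. by move=> GH A B HA GB; rewrite setIC GH// muleC. Qed.

(** For fixed B in [H], both A -> P(A and B) and A -> P(B) P(A) are finite measures. They agree on
    the pi-system [G], hence on the sigma-algebra it generates. *)
Lemma indep_sets_generated (G H : set (set Omega)) :
  G `<=` measurable -> H `<=` measurable -> setI_closed G -> G setT ->
  indep_sets G H -> indep_sets <<s G >> H.
Proof.
move=> Gm Hm GI GT GH A B GA HB.
have mB := Hm _ HB.
pose r : {nonneg R} := NngNum (fine_ge0 (measure_ge0 P B)).
have PB : (r%:num%:E = P B)%E by rewrite /= fineK ?fin_num_measure.
have cov : \bigcup_(k in [set: nat]) [set: Omega] = setT.
  by rewrite bigcup_const//; exists 0%N.
suff : mrestr P mB A = mscale r P A by rewrite /mrestr /mscale PB muleC.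
pose m2 : {measure set Omega -> \bar R} := mscale r P.
pose m1 : {measure set Omega -> \bar R} := mrestr P mB.
rewrite -[LHS]/(m1 A) -[RHS]/(m2 A).
apply: (@g_sigma_algebra_measure_unique d R Omega G Gm (fun=> setT) (fun=> GT) cov
  m1 m2 GI _ _ A GA) => [C GC|_].
  by rewrite /m1/= /mrestr GH// muleC -PB.
by rewrite /m1/= /mrestr setTI (le_lt_trans (probability_le1 P mB))// ltry.
Qed.

Lemma indep_generated (G H : set (set Omega)) :
  G `<=` measurable -> H `<=` measurable -> setI_closed G -> setI_closed H ->
  G setT -> H setT -> indep_sets G H -> indep_sets <<s G >> <<s H >>.
Proof.
move=> Gm Hm GI HI GT HT GH.
have sGm := smallest_sub (@sigma_algebra_measurable _ Omega) Gm.
apply: indep_setsC; apply: indep_sets_generated => //.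
exact/indep_setsC/indep_sets_generated.
Qed.

(** The rectangles over [J]: a pi-system generating the join of the [G i] for i in [J], on which the
    product formula can be checked directly. *)
Definition block {I : finType} (G : I -> set (set Omega)) (J : {set I}) :
    set (set Omega) :=
  [set B | exists2 A : I -> set Omega, (forall i, i \in J -> G i (A i)) &
     B = \bigcap_(i in [set i | i \in J]) A i].

Lemma indep_blocks {I : finType} (G : I -> set (set Omega)) (J K : {set I}) :
  (forall i, G i `<=` measurable) -> (forall i, setI_closed (G i)) ->
  (forall i, G i setT) -> mutually_independent P G -> (forall i, i \in J -> i \notin K) ->
  indep_sets <<s block G J >> <<s block G K >>.
Proof.
move=> Gm GI GT indG JK.
have blockm L : block G L `<=` measurable.
  move=> _ [A GA ->]; apply: fin_bigcap_measurable => // i Li.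
  exact/Gm/GA.
have blockI L : setI_closed (block G L).
  move=> _ _ [A GA ->] [B GB ->]; exists (fun i => A i `&` B i).
    by move=> i iL; apply: GI; [exact: GA|exact: GB].
  by rewrite bigcapI.
have blockT L : block G L setT.
  by exists (fun=> setT) => //; rewrite bigcapT.
apply: indep_generated => // _ _ [A GA ->] [B GB ->].
(* As the blocks are disjoint, the two rectangles glue into a single family over their union, and
   the product formula is used for the union, for [J] and for [K]. *)
pose C i := if i \in J then A i else B i.
have CA i : i \in J -> C i = A i by rewrite /C => ->.
have CB i : i \in K -> C i = B i.
  by rewrite /C; case: ifP => // /JK /negP.
have GC (L : {set I}) : {subset L <= J :|: K} -> forall i, i \in L -> G i (C i).
  move=> LJK i /LJK; rewrite inE => /orP[iJ|iK].
    by rewrite CA//; exact: GA.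
  by rewrite CB//; exact: GB.
have -> : \bigcap_(i in [set i | i \in J]) A i = \bigcap_(i in [set i | i \in J]) C i.
  by apply: eq_bigcapr => i /= iJ; rewrite CA.
have -> : \bigcap_(i in [set i | i \in K]) B i = \bigcap_(i in [set i | i \in K]) C i.
  by apply: eq_bigcapr => i /= iJ; rewrite CB.
rewrite -bigcap_setU.
have -> : [set i | i \in J] `|` [set i | i \in K] = [set i | i \in J :|: K].
  by apply/seteqP; split=> i /=; rewrite inE => /orP.
rewrite !indG; last 3 first.
- by apply: GC; move=> i; rewrite inE orbC => ->.
- by apply: GC; move=> i; rewrite inE => ->.
- by apply: GC.
rewrite (big_setID J)/=; congr (_ * _)%E; apply: eq_bigl => i; rewrite !inE.
  by rewrite andbC; case: (i \in J).
by have [/JK/negbTE ->|] := boolP (i \in J).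
Qed.

(** Retyping [Omega] with the sigma-algebra generated by a block turns dependence on the sources in
    [J] alone into ordinary measurability, which composite expressions inherit from the usual
    closure lemmas. *)
Lemma measurable_fun_block {I : finType} (G : I -> set (set Omega)) (J : {set I})
    (i : I) {d'} {T : measurableType d'} (X : {RV P >-> T}) :
  (forall i, G i setT) -> i \in J -> sigma_RV X `<=` G i ->
  measurable_fun setT (X : g_sigma_algebraType (block G J) -> T).
Proof.
move=> GT iJ XG _ A mA; rewrite setTI; apply: sub_sigma_algebra.
(* The rectangle constrains coordinate [i] only. *)
exists (fun k => if k == i then X @^-1` A else setT).
  move=> k _; case: eqP => // ->; apply: XG; exists A => //.
  by rewrite setTI.
apply/seteqP; split=> [w Aw k _|w]; first by case: eqP.
by move=> /(_ i iJ); rewrite eqxx.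
Qed.

Lemma Lfun2P (X : Omega -> R) : measurable_fun setT X ->
  (\int[P]_w (X w ^+ 2)%:E < +oo)%E -> X \in Lfun P 2%:E.
Proof.
move=> mX iX; apply/andP; split; first by rewrite inE.
rewrite inE/= /finite_norm unlock /Lnorm.
apply: poweR_lty; apply: le_lt_trans iX; rewrite le_eqVlt; apply/orP; left.
apply/eqP; apply: eq_integral => w _ /=.
by rewrite powR_mulrn// -normrX ger0_norm ?sqr_ge0.
Qed.

End Independence.

(** * Uncorrelated sums *)

Section ConditionallyCentered.
Context {d : measure_display} {Omega : measurableType d} {R : realType}.
Variable P : probability Omega R.
Context {d1 d2 : measure_display} {T1 : measurableType d1} {T2 : measurableType d2}.
Variables (U : {RV P >-> T1}) (V : {RV P >-> T2}).
Hypothesis UV : forall A B, measurable A -> measurable B ->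
  (P (U @^-1` A `&` V @^-1` B) = P (U @^-1` A) * P (V @^-1` B))%E.

Let muU : probability T1 R := distribution P U.
Let muV : probability T2 R := distribution P V.
Let mW : measurable_fun setT (fun w => (U w, V w)).
Proof. exact: measurable_fun_pair. Qed.
Let W : {RV P >-> (T1 * T2)%type} := HB.pack (fun w => (U w, V w))
  (isMeasurableFun.Build _ _ _ _ _ mW).

(** A product measure is determined by its values on rectangles, which is where [UV] gives the
    formula. *)
Lemma joint_lawE A : measurable A -> (muU \x muV)%E A = distribution P W A.
Proof.
apply: product_measure_unique => B C mB mC.
rewrite /= /distribution/= /pushforward/= -UV//.
Qed.

Lemma ge0_integral_joint_law (f : T1 * T2 -> \bar R) :
  measurable_fun setT f -> (forall z, 0 <= f z)%E ->
  (\int[P]_w f (U w, V w) = \int[muU]_t \int[muV]_x f (t, x))%E.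
Proof.
move=> mf f0; rewrite -fubini_tonelli1//.
rewrite (eq_measure_integral (distribution P W)); last by move=> A mA _; exact: joint_lawE.
by rewrite (ge0_integral_distribution W mf f0).
Qed.

(** Statements conditional on [U] are put as statements on the sections of [G] under the law of [V],
    so no conditional expectation has to be built. The order matters: Tonelli first bounds the
    second moment, which makes [G] integrable, and only then does Fubini give mean 0. *)
Lemma conditionally_centered (G : T1 * T2 -> R) (s : T1 -> R) :
  measurable_fun setT G -> measurable_fun setT s -> 
  (forall t, \int[muV]_x (G (t, x))%:E = 0)%E ->
  (forall t, \int[muV]_x (G (t, x) ^+ 2)%:E <= (s t)%:E)%E ->
  (\int[P]_w (s (U w))%:E < +oo)%E ->
  [/\ (fun w => G (U w, V w)) \in Lfun P 2%:E,
      ('E_P[fun w => G (U w, V w)] = 0)%E &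
      ('E_P[fun w => (G (U w, V w) ^+ 2)%R] <= 'E_P[s \o U])%E].
Proof.
move=> mG ms G0 Gs sU.
have s0 t : 0 <= s t.
  rewrite -lee_fin (le_trans _ (Gs t))// integral_ge0// => x _.
  by rewrite lee_fin sqr_ge0.
have mG2 : measurable_fun setT (fun z => (G z ^+ 2)%:E).
  by apply/measurable_EFinP; exact: measurable_funX.
have G2s : (\int[P]_w (G (U w, V w) ^+ 2)%:E <= \int[P]_w (s (U w))%:E)%E.
  rewrite (@ge0_integral_joint_law (fun z => (G z ^+ 2)%:E))//; last first.
    by move=> z; rewrite lee_fin sqr_ge0.
  have -> : (\int[P]_w (s (U w))%:E = \int[muU]_t (s t)%:E)%E.
    rewrite (ge0_integral_distribution U)//; last exact/measurable_EFinP.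
  apply: ge0_le_integral => //.
  - by move=> t _; apply: integral_ge0 => x _; rewrite lee_fin sqr_ge0.
  - apply: (@measurable_fun_fubini_tonelli_F _ _ T1 T2 R muV (fun z => (G z ^+ 2)%:E)) => //.
    by move=> z; rewrite lee_fin sqr_ge0.
  - exact/measurable_EFinP.
have mGW : measurable_fun setT (fun w => G (U w, V w)) by exact: measurableT_comp.
have L2G : (fun w => G (U w, V w)) \in Lfun P 2%:E.
  by apply: Lfun2P => //; exact: le_lt_trans sU.
split => //; last by rewrite unlock.
have /Lfun1_integrable iG : (fun w => G (U w, V w)) \in Lfun P 1.
  by apply: Lfun_subset12 => //; exact: fin_num_measure.
have mEG : measurable_fun setT (EFin \o G) by exact/measurable_EFinP.
rewrite unlock -[LHS]/(\int[P]_w ((EFin \o G) \o W) w)%E -integral_distribution//.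
rewrite (eq_measure_integral (muU \x muV)%E); last by move=> A mA _; exact/esym/joint_lawE.
rewrite -integral12_prod_meas1.
  by rewrite integral0_eq// => t _; exact: G0.
apply/integrableP; split => //.
rewrite (eq_measure_integral (distribution P W)); last by move=> A mA _; exact: joint_lawE.
rewrite ge0_integral_distribution//; last exact: measurableT_comp.
by case/integrableP : iG.
Qed.

End ConditionallyCentered.

Section Covariance.
Context {d : measure_display} {Omega : measurableType d} {R : realType}.
Variable P : probability Omega R.
Implicit Types X Y : Omega -> R.

Lemma Lfun2_sub_cst X c : X \in Lfun P 2%:E -> X \- cst c \in Lfun P 2%:E.
Proof.
have H : (1 <= 2%:E :> \bar R)%E by rewrite lee1n.
by move=> X2; apply: rpredB; [exact: X2|exact: Lfun_cst].
Qed.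

(** An instance of [conditionally_centered] for G(x, y) = (x - EX)(y - EY): with x fixed, the second
    factor is centered, and the section has second moment (x - EX)^2 Var Y, which is [s x]. *)
Lemma indep_covariance0 X Y : X \in Lfun P 2%:E -> Y \in Lfun P 2%:E ->
  (forall A B, measurable A -> measurable B ->
    P (X @^-1` A `&` Y @^-1` B) = P (X @^-1` A) * P (Y @^-1` B))%E ->
  covariance P X Y = 0%E.
Proof.
move=> LX LY XY.
have mX : measurable_fun setT X by case/andP: LX; rewrite inE.
have mY : measurable_fun setT Y by case/andP: LY; rewrite inE.
pose U : {RV P >-> R} := HB.pack X (isMeasurableFun.Build _ _ _ _ _ mX).
pose V : {RV P >-> R} := HB.pack Y (isMeasurableFun.Build _ _ _ _ _ mY).
rewrite unlock.
pose G (z : R * R) := (z.1 - fine ('E_P[X])%E) * (z.2 - fine ('E_P[Y])%E).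
have X1 : X \in Lfun P 1 by rewrite Lfun_subset12// fin_num_measure.
have Y1 : Y \in Lfun P 1 by rewrite Lfun_subset12// fin_num_measure.
pose Y0 := Y \- cst (fine ('E_P[Y])%E).
have Y02 : Y0 \in Lfun P 2%:E by exact: Lfun2_sub_cst.
have X02 : (X \- cst (fine ('E_P[X])%E)) \in Lfun P 2%:E by exact: Lfun2_sub_cst.
have Y01 : Y0 \in Lfun P 1 by rewrite Lfun_subset12// fin_num_measure.
have EY0 : ('E_P[Y0] = 0)%E.
  by rewrite expectationB ?Lfun_cst// expectation_cst fineK ?subee ?expectation_fin_num.
have mG : measurable_fun setT G.
  by apply: measurable_funM; apply: measurable_funB.
have mVG t : measurable_fun setT (fun y => (G (t, y))%:E).
  by apply/measurable_EFinP; exact: measurable_fun_pair2.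
pose s t := (t - fine ('E_P[X])%E) ^+ 2 * fine ('V_P[Y])%E.
have EG t : ('E_P[fun w => G (t, Y w)] = 0)%E.
  rewrite (_ : (fun w => _) = (t - fine ('E_P[X])%E) \o* Y0); last first.
    by apply/funext => w; rewrite /G/= mulrC.
  by rewrite expectationZl// EY0 mule0.
have iG t : P.-integrable setT (fun w => (G (t, Y w))%:E).
  apply/Lfun1_integrable.
  rewrite (_ : (fun w => _) = (t - fine ('E_P[X])%E) \o* Y0); last first.
    by apply/funext => w; rewrite /G/= mulrC.
  by rewrite Lfun_scale.
have [|t|t||_ + _] := @conditionally_centered _ _ _ P _ _ _ _ U V XY G s mG.
- by apply: measurable_funM => //; apply: measurable_funX; exact: measurable_funB.
- by rewrite (integral_distribution (X := V) (mVG t) (iG t)) -[RHS](EG t) unlock.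
- rewrite (@ge0_integral_distribution _ _ _ _ _ P V (fun y => (G (t, y) ^+ 2)%:E)); last 2 first.
  + by apply/measurable_EFinP; apply: measurable_funX; apply: measurable_fun_pair2.
  + by move=> y; rewrite lee_fin sqr_ge0.
  rewrite /s EFinM fineK ?variance_fin_num// /variance !unlock.
  rewrite -ge0_integralZl//=; last 3 first.
  + by apply/measurable_EFinP; apply: measurable_funM; apply: measurable_funB.
  + by move=> w _; rewrite lee_fin -expr2 sqr_ge0.
  + by rewrite lee_fin sqr_ge0.
  rewrite le_eqVlt; apply/orP; left; apply/eqP; apply: eq_integral => w _.
  by rewrite /= -EFinM /G exprMn/= (expr2 (Y w - _)) unlock.
- pose sX : Omega -> R := fun w => (X w - fine ('E_P[X])%E) ^+ 2.
  have -> : (\int[P]_w (s (U w))%:E = 'E_P[fine 'V_P[Y] \o* sX])%E by rewrite expectation.unlock.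
  have X0sq : sX \in Lfun P 1.
    exact/Lfun1_integrable/(Lfun2_integrable_sqr X02).
  by rewrite expectationZl// ltey_eq fin_numM ?expectation_fin_num.
by [].
Qed.

Lemma covariance_sumr (I : eqType) (r : seq I) (F : I -> Omega -> R) X :
  X \in Lfun P 2%:E -> (forall i, F i \in Lfun P 2%:E) ->
  covariance P X (\sum_(i <- r) F i) = (\sum_(i <- r) covariance P X (F i))%E.
Proof.
move=> X2 F2; elim: r => [|i r IH]; first by rewrite !big_nil covariance_cst_r.
by rewrite !big_cons covarianceDr ?IH// rpred_sum ?lee1n.
Qed.

Lemma variance_sum_uncorrelated (I : eqType) (r : seq I) (F : I -> Omega -> R) :
  uniq r -> (forall i, F i \in Lfun P 2%:E) ->
  (forall i j, i != j -> covariance P (F i) (F j) = 0%E) ->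
  ('V_P[(\sum_(i <- r) F i)%R] = \sum_(i <- r) 'V_P[F i])%E.
Proof.
move=> + F2 F0; elim: r => [_|i r IH /= /andP[ir ur]]; first by rewrite !big_nil variance_cst.
rewrite !big_cons varianceD// ?rpred_sum ?lee1n// IH// covariance_sumr//.
rewrite [X in (_ + _ * X)%E]big_seq [X in (_ + _ * X)%E]big1 ?mule0 ?adde0// => j jr.
by apply: F0; apply: contraNneq ir => ->.
Qed.
End Covariance.

(** * Borel measurability *)

Section BorelSimplex.
Context {R : realType} {n : nat}.

Lemma continuous_borel_measurable m (f : 'cV[R]_n -> 'cV[R]_m) : continuous f ->
  measurable_fun setT (f : borel_cV R n -> borel_cV R m).
Proof.
move=> cf; apply: (@measurability _ _ (borel_cV R n) (borel_cV R m) setT f (@open 'cV[R]_m)) => //.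
move=> _ [A oA <-]; rewrite setTI; apply: sub_sigma_algebra.
by apply: open_comp oA => x _; exact: cf.
Qed.

Lemma continuous_borel_measurable_real (f : 'cV[R]_n -> R) : continuous f ->
  measurable_fun setT (f : borel_cV R n -> R).
Proof.
move=> cf; apply: (@measurability _ _ (borel_cV R n) (measurableTypeR R) _ f _
  (RGenOpens.measurableE R)) => //.
move=> _ [A [a [b ->]] <-]; rewrite setTI; apply: sub_sigma_algebra.
by apply: open_comp; [move=> x _; exact: cf|exact: interval_open].
Qed.

Lemma measurable_coord i : measurable_fun setT (fun q : borel_cV R n => (q : 'cV[R]_n) i 0).
Proof. by apply: continuous_borel_measurable_real => q; exact: coord_continuous. Qed.

Lemma measurable_simplex : measurable (simplex : set (borel_cV R n)).
Proof.
have -> : simplex = (fun q : borel_cV R n => \sum_i (q : 'cV[R]_n) i 0) @^-1` [set 1] `&`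
   \bigcap_(i in [set: 'I_n]) ((fun q : borel_cV R n => (q : 'cV[R]_n) i 0) @^-1` `[0, +oo[).
  apply/seteqP; split=> q [q1 q0]; split=> // i; have := q0 i; rewrite /= in_itv/= andbT //.
  by apply.
apply: measurableI; last first.
  apply: fin_bigcap_measurable => // i _; rewrite -[X in measurable X]setTI.
  exact: measurable_coord.
rewrite -[X in measurable X]setTI.
have : measurable_fun setT (fun q : borel_cV R n => \sum_i (q : 'cV[R]_n) i 0).
  by apply: measurable_sum => i; exact: measurable_coord.
exact.
Qed.

Lemma enorm_continuous : continuous (@enorm R n).
Proof.
move=> v; apply: continuous_comp; last exact: sqrt_continuous.
apply: (continuous_big (op := +%R)) => [|i _ w]; first exact: add_continuous.
by apply: (@continuous_comp _ _ _ (fun u : 'cV[R]_n => u i 0) (fun x : R => x ^+ 2));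
  [exact: coord_continuous|exact: exprn_continuous].
Qed.

(** Neighborhoods come from the sup norm while the Lipschitz conditions use [enorm]; continuity of
    [enorm] at 0 links the two. *)
Lemma near_enorm_sub (x : 'cV[R]_n) (e : R) : 0 < e ->
  \forall y \near x, enorm (x - y) < e.
Proof.
have xy : x - y @[y --> x] --> x - x.
  exact: (@cvgB _ _ _ (nbhs x) (nbhs_filter x) (cst x) id _ _
    (@cvg_cst _ x _ _ (nbhs_filter x)) (@cvg_id _ (nbhs x))).
have := @cvg_comp _ _ _ (fun y => x - y) (@enorm R n) _ _ _ xy (@enorm_continuous _).
rewrite subrr enorm0 => /cvgrPdist_lt/(_ e) + e0 => /(_ e0).
by apply: filterS => y; rewrite sub0r normrN ger0_norm ?enorm_ge0.
Qed.

Lemma measurable_simplex_lipschitz (f : 'cV[R]_n -> R) (L : R) :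
  simplex_lipschitz Num.norm f L ->
  measurable_fun (simplex : set (borel_cV R n)) (f : borel_cV R n -> R).
Proof.
move=> fL.
have cf : {within simplex, continuous f}.
  apply/subspace_continuousP => x sx; apply/cvgrPdist_lt => e e0.
  have L1 : 0 < `|L| + 1 by rewrite ltr_wpDl.
  rewrite near_withinE.
  have : \forall y \near x, enorm (x - y) < (`|L| + 1)^-1 * e.
    by apply: near_enorm_sub; rewrite mulr_gt0 ?invr_gt0.
  apply: filterS => y; rewrite ltr_pdivlMl// => xy sy.
  apply: (le_lt_trans (fL _ _ sx sy)); apply: le_lt_trans xy.
  by rewrite ler_wpM2r ?enorm_ge0// (le_trans (ler_norm _))// lerDl.
move=> mS; apply: (@measurability _ _ (borel_cV R n) (measurableTypeR R) _ f _
  (RGenOpens.measurableE R)) => //.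
move=> _ [A [a [b ->]] <-].
(* Continuity relative to the simplex makes this preimage the trace of an open set of the whole
   space, which is Borel. *)
have : open (f @^-1` `]a, b[%classic : set (subspace simplex)).
  by apply: open_comp; [move=> x _; exact: cf|exact: interval_open].
move=> /open_subspaceP[V oV VE].
rewrite setIC -VE; apply: measurableI; last exact: measurable_simplex.
exact: sub_sigma_algebra.
Qed.

End BorelSimplex.

(** * Evaluation noise *)

Section Noise.
Context {R : realType} {n : nat}.
Context {d : measure_display} {Omega : measurableType d} (P : probability Omega R).
Context {d' : measure_display} {Xi : measurableType d'}.
Variables (zeta : Xi -> 'cV[R]_n -> R) (Z : 'cV[R]_n -> R) (L0 sigma : R).
Variable xi : {RV P >-> Xi}.
Hypothesis zeta_meas : measurable_fun (setT `*` (simplex : set (borel_cV R n)))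
  (fun xq : Xi * borel_cV R n => zeta xq.1 xq.2).
Hypothesis Z_lip : simplex_lipschitz Num.norm Z L0.
Hypothesis unbiased : forall q, simplex q -> ('E_P[fun w => zeta (xi w) q] = (Z q)%:E)%E.
Hypothesis var_le : forall q, simplex q ->
  ('V_P[fun w => zeta (xi w) q] <= (sigma ^+ 2)%:E)%E.

(* Extending by 0 outside the simplex makes everything jointly measurable on the
   whole product space. *)
Definition zeta_ext : Xi * borel_cV R n -> R :=
  (fun xq => zeta xq.1 xq.2) \_ (setT `*` simplex).

Definition Z_ext : borel_cV R n -> R := Z \_ simplex.

(** The point comes before the seed, to match the roles of [U] (the perturbation, conditioned on)
    and [V] (the seed, integrated) in [conditionally_centered]. *)
Definition noise (qx : borel_cV R n * Xi) : R := zeta_ext (qx.2, qx.1) - Z_ext qx.1.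

Lemma zeta_extE x q : simplex q -> zeta_ext (x, q) = zeta x q.
Proof. by move=> sq; rewrite /zeta_ext patchE mem_set. Qed.

Lemma Z_extE q : simplex q -> Z_ext q = Z q.
Proof. by move=> sq; rewrite /Z_ext patchE mem_set. Qed.

Lemma noise_out q x : ~ simplex q -> noise (q, x) = 0.
Proof.
move=> sq; rewrite /noise /zeta_ext /Z_ext !patchE !memNset ?subrr//.
by move=> [].
Qed.

Lemma measurable_zeta_ext : measurable_fun setT zeta_ext.
Proof.
apply/(measurable_restrictT _ _).1 => //; apply: measurableX => //.
exact: measurable_simplex.
Qed.

Lemma measurable_Z_ext : measurable_fun setT Z_ext.
Proof.
apply/(measurable_restrictT _ _).1; first exact: measurable_simplex.
exact: measurable_simplex_lipschitz Z_lip.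
Qed.

Lemma measurable_noise : measurable_fun setT noise.
Proof.
apply: measurable_funB.
  apply: (measurableT_comp measurable_zeta_ext).
  by apply: measurable_fun_pair; [exact: measurable_snd|exact: measurable_fst].
exact: measurableT_comp measurable_Z_ext measurable_fst.
Qed.

Variable xi' : {RV P >-> Xi}.
Hypothesis xi'_law : same_law xi' xi.

(** Claimed for every [q], since [conditionally_centered] asks for all sections; off the simplex the
    noise is 0. On the simplex the law of [xi'] is exchanged for that of [xi], about which the
    assumptions speak. *)
Lemma noise_centered q :
  (\int[distribution P xi']_x (noise (q, x))%:E = 0)%E /\
  (\int[distribution P xi']_x (noise (q, x) ^+ 2)%:E <= (sigma ^+ 2)%:E)%E.
Proof.
have [sq|sq] := pselect (simplex q); last first.
  split.
    by rewrite integral0_eq// => x _; rewrite noise_out.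
  rewrite integral0_eq ?lee_fin ?sqr_ge0// => x _.
  by rewrite noise_out// expr0n.
have mN : measurable_fun setT (fun x => noise (q, x)).
  exact: (measurable_fun_pair2 _ measurable_noise).
have lawE (f : Xi -> \bar R) :
    (\int[distribution P xi']_x f x = \int[distribution P xi]_x f x)%E.
  by apply: eq_measure_integral => A mA _; exact: xi'_law.
rewrite !lawE.
have NE w : noise (q, xi w) = zeta (xi w) q - Z q.
  by rewrite /noise/= zeta_extE// Z_extE.
(* With the mean [Z q] inserted, the variance of the evaluation is exactly this integral. It also
   yields the integrability needed to split the mean of the difference. *)
have N2 : (\int[P]_w (noise (q, xi w) ^+ 2)%:E <= (sigma ^+ 2)%:E)%E.
  have := var_le sq; rewrite /variance covariance.unlock unbiased//= expectation.unlock.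
  by congr (_ <= _)%E; apply: eq_integral => w _; rewrite NE expr2.
have mNx : measurable_fun setT (fun w => noise (q, xi w)).
  exact: (measurableT_comp mN).
have LN : (fun w => noise (q, xi w)) \in Lfun P 1.
  apply: Lfun_subset12; first exact: fin_num_measure.
  by apply: Lfun2P => //; apply: (le_lt_trans N2); rewrite ltry.
split; last first.
  rewrite (@ge0_integral_distribution _ _ _ _ _ P xi (fun x => (noise (q, x) ^+ 2)%:E))//.
    by apply/measurable_EFinP; exact: measurable_funX.
  by move=> y; rewrite lee_fin sqr_ge0.
have iN : P.-integrable setT (EFin \o (fun w => noise (q, xi w))) by exact/Lfun1_integrable.
rewrite (@integral_distribution _ _ _ _ _ P xi (fun x => (noise (q, x))%:E)) //; last first.
  exact/measurable_EFinP.
rewrite -[LHS]/(\int[P]_w (noise (q, xi w))%:E)%E.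
have -> : (\int[P]_w (noise (q, xi w))%:E = 'E_P[(fun w => zeta (xi w) q) \- cst (Z q)])%E.
  by rewrite expectation.unlock; apply: eq_integral => w _; rewrite NE.
have LZ : (fun w => zeta (xi w) q) \in Lfun P 1.
  rewrite (_ : (fun w => _) = (fun w => noise (q, xi w)) \+ cst (Z q)); last first.
    by apply/funext => w /=; rewrite NE subrK.
  by apply: rpredD => //; exact: Lfun_cst.
by rewrite expectationB ?Lfun_cst// unbiased// expectation_cst subee.
Qed.

End Noise.

(** * A single summand of the estimator *)

Section BoundedRV.
Context {d : measure_display} {Omega : measurableType d} {R : realType}.
Variable P : probability Omega R.
Implicit Types X Y : Omega -> R.

(** Everything built from the perturbation alone is bounded, because the simplex is; closure under
    sums and products then settles integrability at once. *)
Definition bounded_rv X : Prop :=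
  measurable_fun setT X /\ exists C, forall w, `|X w| <= C.

Lemma bounded_rv_cst c : bounded_rv (fun=> c).
Proof. by split=> //; exists `|c|. Qed.

Lemma bounded_rvD X Y : bounded_rv X -> bounded_rv Y -> bounded_rv (fun w => X w + Y w).
Proof.
move=> [mX [C XC]] [mY [D YD]]; split; first exact: measurable_funD.
by exists (C + D) => w; rewrite (le_trans (ler_normD _ _))// lerD.
Qed.

Lemma bounded_rvM X Y : bounded_rv X -> bounded_rv Y -> bounded_rv (fun w => X w * Y w).
Proof.
move=> [mX [C XC]] [mY [D YD]]; split; first exact: measurable_funM.
by exists (C * D) => w; rewrite normrM ler_pM.
Qed.

Lemma bounded_rvB X Y : bounded_rv X -> bounded_rv Y -> bounded_rv (fun w => X w - Y w).
Proof.
move=> bX bY; rewrite (_ : (fun w => _) = (fun w => X w + (-1) * Y w)); last first.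
  by apply/funext => w; rewrite mulN1r.
by apply: bounded_rvD => //; apply: bounded_rvM => //; exact: bounded_rv_cst.
Qed.

Lemma bounded_rv_sum (I : Type) (r : seq I) (F : I -> Omega -> R) :
  (forall i, bounded_rv (F i)) -> bounded_rv (fun w => \sum_(i <- r) F i w).
Proof.
move=> bF; elim: r => [|i r IH].
  by under eq_fun do rewrite big_nil; exact: bounded_rv_cst.
by under eq_fun do rewrite big_cons; exact: bounded_rvD.
Qed.

Lemma bounded_rv_Lfun2 X : bounded_rv X -> X \in Lfun P 2%:E.
Proof.
move=> [mX [C XC]]; apply: Lfun2P => //.
apply: (@le_lt_trans _ _ (\int[P]_w (cst (C ^+ 2)%:E) w)%E).
  apply: ge0_le_integral => //.
  - by move=> w _; rewrite lee_fin sqr_ge0.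
  - by apply/measurable_EFinP; exact: measurable_funX.
  - move=> w _; rewrite lee_fin -real_normK ?num_real// ler_pXn2r ?nnegrE//.
    exact: le_trans (XC w).
by rewrite integral_cst//= probability_setT mule1 ltry.
Qed.

Lemma Lfun2_Lfun1 X : X \in Lfun P 2%:E -> X \in Lfun P 1.
Proof. by apply: Lfun_subset12; exact: fin_num_measure. Qed.

Lemma bounded_rv_Lfun1 X : bounded_rv X -> X \in Lfun P 1.
Proof. by move=> /bounded_rv_Lfun2/Lfun2_Lfun1. Qed.

Definition mean X : R := fine ('E_P[X])%E.

Lemma EFin_mean X : X \in Lfun P 1 -> ('E_P[X] = (mean X)%:E)%E.
Proof. by move=> X1; rewrite fineK// expectation_fin_num. Qed.

Lemma meanD X Y : X \in Lfun P 1 -> Y \in Lfun P 1 ->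
  mean (fun w => X w + Y w) = mean X + mean Y.
Proof. by move=> X1 Y1; rewrite /mean expectationD// fineD ?expectation_fin_num. Qed.

Lemma meanZ c X : X \in Lfun P 1 -> mean (fun w => c * X w) = c * mean X.
Proof.
move=> X1; rewrite /mean (_ : (fun w => _) = c \o* X); last first.
  by apply/funext => w /=; rewrite mulrC.
by rewrite expectationZl// fineM ?expectation_fin_num.
Qed.

Lemma mean_sum (I : Type) (r : seq I) (F : I -> Omega -> R) :
  (forall i, F i \in Lfun P 1) ->
  mean (fun w => \sum_(i <- r) F i w) = \sum_(i <- r) mean (F i).
Proof.
move=> F1; elim: r => [|i r IH].
  under eq_fun do rewrite big_nil.
  by rewrite big_nil /mean (expectation_cst P 0).
under eq_fun do rewrite big_cons.
rewrite big_cons meanD ?IH// (_ : (fun w => _) = \sum_(j <- r) F j); last first.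
  by apply/funext => w; rewrite fct_sumE.
have h1 : (1 <= 1 :> \bar R)%E by [].
exact: rpred_sum.
Qed.

Lemma mean_sum_bounded (I : Type) (r : seq I) (F : I -> Omega -> R) :
  (forall i, bounded_rv (F i)) ->
  mean (fun w => \sum_(i <- r) F i w) = \sum_(i <- r) mean (F i).
Proof. by move=> bF; apply: mean_sum => i; exact: bounded_rv_Lfun1. Qed.

Lemma ler_mean X Y : bounded_rv X -> bounded_rv Y -> (forall w, X w <= Y w) ->
  mean X <= mean Y.
Proof.
move=> bX bY XY; rewrite /mean expectation.unlock.
apply: (@le_Rintegral _ _ _ P) => //; exact/Lfun1_integrable/bounded_rv_Lfun1.
Qed.

End BoundedRV.

(** * Bias and second moment of one summand *)

Section Sample.
Context {R : realType} {n : nat}.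
Context {d : measure_display} {Omega : measurableType d} (P : probability Omega R).
Context {d' : measure_display} {Xi : measurableType d'}.
Variables (zeta : Xi -> 'cV[R]_n -> R) (Z : 'cV[R]_n -> R) (L0 L2 M sigma : R).
Variable xi : {RV P >-> Xi}.
Hypothesis zeta_meas : measurable_fun (setT `*` (simplex : set (borel_cV R n)))
  (fun xq : Xi * borel_cV R n => zeta xq.1 xq.2).
Hypothesis Z_C2 : simplex_C2 Z.
Hypothesis Z_lip : simplex_lipschitz Num.norm Z L0.
Hypothesis hess_lip : simplex_lipschitz spectral_norm (hess Z) L2.
Hypothesis grad_le : forall q, simplex q -> enorm (grad Z q) <= M.
Hypothesis unbiased : forall q, simplex q -> ('E_P[fun w => zeta (xi w) q] = (Z q)%:E)%E.
Hypothesis var_le : forall q, simplex q ->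
  ('V_P[fun w => zeta (xi w) q] <= (sigma ^+ 2)%:E)%E.
Variables (p : 'cV[R]_n) (c gamma lambda : R) (D : {RV P >-> borel_cV R n}).
Hypothesis p_simplex : simplex p.
Hypothesis c_gt0 : 0 < c.
Hypothesis D_simplex : forall w, simplex (D w).
Hypothesis plus_simplex : forall w, simplex (plus_point c p (D w)).
Hypothesis minus_simplex : forall w, simplex (minus_point c p (D w)).

Definition dev (w : Omega) : 'cV[R]_n := (D w : 'cV[R]_n) - p.

Hypothesis moment2 : forall i k,
  gamma * mean P (fun w => dev w i 0 * dev w k 0) = (i == k)%:R - lambda.

Definition sym_diff w : R := Z (plus_point c p (D w)) - Z (minus_point c p (D w)).

Lemma plus_pointE w : plus_point c p (D w) = p + c *: dev w.
Proof. by rewrite /plus_point /dev scalerBl scale1r scalerBr addrAC addrA. Qed.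

Lemma minus_pointE w : minus_point c p (D w) = p - c *: dev w.
Proof. by rewrite /minus_point /dev scalerDl scale1r scalerBr opprB addrA. Qed.

Lemma measurable_plus_point :
  measurable_fun setT (plus_point c p : borel_cV R n -> borel_cV R n).
Proof.
apply: continuous_borel_measurable => q.
exact: (@cvgD _ _ _ (nbhs q) (nbhs_filter q) (cst ((1 - c) *: p)) ( *:%R c) _ _
  (@cvg_cst _ _ _ _ (nbhs_filter q)) (@scaler_continuous _ _ c q)).
Qed.

Lemma measurable_minus_point :
  measurable_fun setT (minus_point c p : borel_cV R n -> borel_cV R n).
Proof.
apply: continuous_borel_measurable => q.
exact: (@cvgB _ _ _ (nbhs q) (nbhs_filter q) (cst ((1 + c) *: p)) ( *:%R c) _ _
  (@cvg_cst _ _ _ _ (nbhs_filter q)) (@scaler_continuous _ _ c q)).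
Qed.

Lemma bounded_rv_dev i : bounded_rv (fun w => dev w i 0).
Proof.
split.
  rewrite (_ : (fun w => _) = (fun w => (D w : 'cV[R]_n) i 0 - p i 0)); last first.
    by apply/funext => w; rewrite /dev !mxE.
  by apply: measurable_funB => //; exact: (measurableT_comp (measurable_coord i)).
exists 1 => w; rewrite /dev !mxE ler_norml.
have := simplex_coord_le1 i p_simplex; have := simplex_coord_le1 i (D_simplex w).
have := p_simplex.2 i; have := (D_simplex w).2 i; lra.
Qed.

Lemma enorm_dev_le2 w : enorm (dev w) <= 2.
Proof.
have := simplex_sqr_dist_le2 (D_simplex w) p_simplex.
have := enorm_ge0 (dev w); rewrite -/(dev w); nra.
Qed.

Lemma sym_diff_bound w : `|sym_diff w| <= 2 * M * (c * enorm (dev w)).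
Proof.
rewrite /sym_diff plus_pointE minus_pointE -[X in X * enorm _]gtr0_norm// -enormZ.
by apply: (sym_diff_le Z_lip) => //; rewrite -?plus_pointE -?minus_pointE//; exact: Z_C2.1.1.
Qed.

Lemma sym_diff_remainder w :
  `|sym_diff w - 2 * c * dotv (grad Z p) (dev w)| <= 2 * `|L2| * c ^+ 3 * enorm (dev w) ^+ 3.
Proof.
have := @sym_diff_taylor _ _ Z p (c *: dev w) L0 L2 Z_C2 Z_lip hess_lip.
rewrite -plus_pointE -minus_pointE enormZ dotvZr (gtr0_norm c_gt0) exprMn !mulrA.
exact.
Qed.

Lemma M_ge0 : 0 <= M.
Proof. exact: le_trans (enorm_ge0 _) (grad_le p_simplex). Qed.

Lemma bounded_rv_sym_diff : bounded_rv sym_diff.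
Proof.
split.
  (* [Z] is measurable only on the simplex, so it is replaced by its extension, with the same values
     at both evaluation points. *)
  rewrite (_ : sym_diff = fun w =>
      Z_ext Z (plus_point c p (D w)) - Z_ext Z (minus_point c p (D w))).
    apply: measurable_funB; apply: (measurableT_comp (measurable_Z_ext Z_lip)).
      exact: (measurableT_comp measurable_plus_point).
    exact: (measurableT_comp measurable_minus_point).
  by apply/funext => w; rewrite !Z_extE.
exists (2 * M * (c * 2)) => w; apply: (le_trans (sym_diff_bound w)).
by rewrite ler_wpM2l ?mulr_ge0 ?M_ge0// ler_wpM2l ?(ltW c_gt0)// enorm_dev_le2.
Qed.

Lemma bounded_rv_dev_sqr i : bounded_rv (fun w => dev w i 0 ^+ 2).
Proof. by under eq_fun do rewrite expr2; apply: bounded_rvM; exact: bounded_rv_dev. Qed.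

Lemma bounded_rv_dev_sym_diff i : bounded_rv (fun w => dev w i 0 * sym_diff w).
Proof. by apply: bounded_rvM; [exact: bounded_rv_dev|exact: bounded_rv_sym_diff]. Qed.

Lemma bounded_rv_dotv_dev (u : 'cV[R]_n) : bounded_rv (fun w => dotv u (dev w)).
Proof.
under eq_fun do rewrite dotvE.
apply: bounded_rv_sum => i; apply: bounded_rvM; first exact: bounded_rv_cst.
exact: bounded_rv_dev.
Qed.

Lemma simplex_dim_gt0 : (0 < n)%N.
Proof.
have [H _] := p_simplex; rewrite lt0n; apply: contra_eq_neq H => n0.
rewrite big1 => [|i _]; first by rewrite eq_sym oner_neq0.
by move: (ltn_ord i); rewrite [X in (_ < X)%N]n0.
Qed.

(* The coordinates of [dev w] sum to 0, so the rows of [I - lambda 1 1'] do too. *)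
Lemma lambdaE : lambda = n%:R^-1.
Proof.
have n0 := simplex_dim_gt0; move: (Ordinal n0) => i0.
have : \sum_k gamma * mean P (fun w => dev w i0 0 * dev w k 0) = 0.
  rewrite -mulr_sumr -mean_sum_bounded; last first.
    by move=> k; apply: bounded_rvM; exact: bounded_rv_dev.
  rewrite [X in mean _ X](_ : _ = fun=> 0); last first.
    apply/funext => w; rewrite -mulr_sumr.
    by rewrite (simplex_sub_sum (D_simplex w) p_simplex) mulr0.
  by rewrite /mean (expectation_cst P 0)/= mulr0.
under eq_bigr do rewrite moment2.
rewrite sumrB (bigD1 i0)//= eqxx big1 ?addr0; last first.
  by move=> k; rewrite eq_sym => /negbTE ->.
rewrite sumr_const card_ord -[lambda *+ n]mulr_natl => /eqP; rewrite subr_eq0 => /eqP E.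
by apply: (@mulfI _ n%:R); rewrite ?pnatr_eq0 -?lt0n// -E mulfV// pnatr_eq0 -lt0n.
Qed.

Lemma mean_sqr_dev_ge0 : 0 <= \sum_i mean P (fun w => dev w i 0 ^+ 2).
Proof.
apply: sumr_ge0 => i _; apply: fine_ge0; apply: expectation_ge0 => w.
exact: sqr_ge0.
Qed.

(** The mean is nonnegative, so the absolute value may enclose the whole product; that product is
    the trace n(1 - 1/n) = n - 1, nonnegative because a nonempty simplex forces n >= 1. *)
Lemma mean_sqr_dev_le : `|gamma| * \sum_i mean P (fun w => dev w i 0 ^+ 2) <= n%:R.
Proof.
rewrite -[X in _ * X]ger0_norm ?mean_sqr_dev_ge0// -normrM mulr_sumr.
under eq_bigr do (under [X in mean _ X]eq_fun do rewrite expr2).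
under eq_bigr do rewrite moment2 eqxx.
rewrite sumr_const card_ord lambdaE -[X in `|X|]mulr_natl mulrBr mulr1.
rewrite mulfV ?pnatr_eq0 -?lt0n ?simplex_dim_gt0//.
have : 1 <= n%:R :> R by rewrite ler1n simplex_dim_gt0.
move=> n1; rewrite ger0_norm; lra.
Qed.

(** Once [lambda] is known to be 1/n, the last term is -eps0 1, so this is the bias vector of a
    single summand. *)
Definition sample_mean_error : 'cV[R]_n :=
  \col_i (gamma / (2 * c) * mean P (fun w => dev w i 0 * sym_diff w))
    - grad Z p + (lambda * \sum_k grad Z p k 0) *: ones.

(** By the second-moment identity the linear part 2c grad'Delta contributes exactly grad - lambda
    (1'grad) 1, so only the Taylor remainder is left. The vector [u] is arbitrary so that the error
    itself can be inserted for it. *)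
Lemma sample_mean_errorE (u : 'cV[R]_n) : dotv u sample_mean_error =
  gamma / (2 * c) * mean P (fun w => dotv u (dev w) *
    (sym_diff w - 2 * c * dotv (grad Z p) (dev w))).
Proof.
pose B i k := fun w => dev w i 0 * dev w k 0.
have bB i k : bounded_rv (B i k) by apply: bounded_rvM; exact: bounded_rv_dev.
have bBg i k : bounded_rv (fun w => grad Z p k 0 * B i k w).
  by apply: bounded_rvM => //; exact: bounded_rv_cst.
have bBs i : bounded_rv (fun w => \sum_k grad Z p k 0 * B i k w) by exact: bounded_rv_sum.
have bT i : bounded_rv (fun w => dev w i 0 * (sym_diff w - 2 * c * dotv (grad Z p) (dev w))).
  apply: bounded_rvM; first exact: bounded_rv_dev.
  apply: bounded_rvB; first exact: bounded_rv_sym_diff.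
  by apply: bounded_rvM; [exact: bounded_rv_cst|exact: bounded_rv_dotv_dev].
have coordE i : sample_mean_error i 0 = gamma / (2 * c) *
    mean P (fun w => dev w i 0 * (sym_diff w - 2 * c * dotv (grad Z p) (dev w))).
  rewrite [X in mean _ X](_ : _ = fun w => dev w i 0 * sym_diff w +
      (- (2 * c)) * \sum_k grad Z p k 0 * B i k w); last first.
    apply/funext => w; rewrite mulrBr mulNr; congr (_ - _).
    rewrite mulrCA dotvE mulr_sumr; congr (_ * _); apply: eq_bigr => k _.
    by rewrite /B; ring.
  rewrite meanD; [|exact/bounded_rv_Lfun1/bounded_rv_dev_sym_diff|]; last first.
    by apply/bounded_rv_Lfun1/bounded_rvM => //; exact: bounded_rv_cst.
  rewrite meanZ ?mean_sum_bounded//; last exact/bounded_rv_Lfun1.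
  under eq_bigr do rewrite meanZ ?bounded_rv_Lfun1//.
  rewrite /sample_mean_error !mxE mulrDr -addrA; congr (_ + _).
  rewrite mulNr mulrN mulrA divfK ?mulr_sumr; last by rewrite mulf_neq0// gt_eqF.
  under [in RHS]eq_bigr do rewrite mulrCA moment2 mulrBr.
  have S1 : \sum_k grad Z p k 0 * (i == k)%:R = grad Z p i 0.
    rewrite (bigD1 i)//= eqxx mulr1 big1 ?addr0// => k.
    by rewrite eq_sym => /negbTE ->; rewrite mulr0.
  rewrite sumrB S1 mxE opprB mulr1 addrC; congr (_ - _).
  by apply: eq_bigr => k _; rewrite mulrC.
rewrite dotvE; under eq_bigr do rewrite coordE mulrCA -meanZ ?bounded_rv_Lfun1//.
rewrite -mulr_sumr -mean_sum_bounded; last first.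
  by move=> i; apply: bounded_rvM => //; exact: bounded_rv_cst.
congr (_ * mean _ _); apply/funext => w.
by rewrite [in RHS]dotvE mulr_suml; apply: eq_bigr => i _; rewrite mulrA.
Qed.

(** Taking u = e in the previous identity bounds |e|^2 by a multiple of |e|, and one factor |e|
    cancels; it is disposed of beforehand when it is 0. *)
Lemma sample_mean_error_le : enorm sample_mean_error <= 2 * n%:R * c ^+ 2 * `|L2|.
Proof.
have [->|e0] := eqVneq (enorm sample_mean_error) 0.
  by rewrite !mulr_ge0 ?exprn_ge0 ?(ltW c_gt0) ?ler0n.
have epos : 0 < enorm sample_mean_error by rewrite lt0r e0 enorm_ge0.
rewrite -(ler_pM2l epos) -expr2 sqr_enorm_dotv sample_mean_errorE.
set e := sample_mean_error in epos *.
pose Q w := \sum_i dev w i 0 ^+ 2.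
have bQ : bounded_rv Q by apply: bounded_rv_sum => i; exact: bounded_rv_dev_sqr.
have QE w : Q w = enorm (dev w) ^+ 2 by rewrite sqr_enorm.
pose T w := dotv e (dev w) * (sym_diff w - 2 * c * dotv (grad Z p) (dev w)).
have bT : bounded_rv T.
  apply: bounded_rvM; first exact: bounded_rv_dotv_dev.
  apply: bounded_rvB; first exact: bounded_rv_sym_diff.
  by apply: bounded_rvM; [exact: bounded_rv_cst|exact: bounded_rv_dotv_dev].
(* The remainder carries 2 |L2| c^3 |Delta|^3 and the test factor |e| |Delta|; replacing |Delta|^4
   by 2 |Delta|^2 makes the 4. Multiplication by |gamma| / (2c) then leaves the final factor 2. *)
pose C := enorm e * (4 * `|L2| * c ^+ 3).
have C0 : 0 <= C by rewrite !mulr_ge0 ?enorm_ge0 ?exprn_ge0 ?(ltW c_gt0).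
have TQ w : `|T w| <= C * Q w.
  rewrite /T normrM; apply: (@le_trans _ _ ((enorm e * enorm (dev w)) *
      (2 * `|L2| * c ^+ 3 * enorm (dev w) ^+ 3))).
    by apply: ler_pM => //; [exact: normr_dotv_le|exact: sym_diff_remainder].
  have := simplex_sqr_dist_le2 (D_simplex w) p_simplex; rewrite -/(dev w) => dev2.
  rewrite (_ : _ * _ = enorm e * (2 * `|L2| * c ^+ 3) * enorm (dev w) ^+ 2
    * enorm (dev w) ^+ 2); last by ring.
  rewrite (_ : C * Q w = enorm e * (2 * `|L2| * c ^+ 3) * enorm (dev w) ^+ 2 * 2); last first.
    by rewrite /C QE; ring.
  by rewrite ler_wpM2l// !mulr_ge0 ?enorm_ge0 ?exprn_ge0 ?(ltW c_gt0).
have bCQ : bounded_rv (fun w => C * Q w) by apply: bounded_rvM => //; exact: bounded_rv_cst.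
have mT : `|mean P T| <= C * \sum_i mean P (fun w => dev w i 0 ^+ 2).
  rewrite -mean_sum_bounded; last by move=> i; exact: bounded_rv_dev_sqr.
  rewrite -(meanZ _ (bounded_rv_Lfun1 P bQ)) ler_norml; apply/andP; split; last first.
    by apply: ler_mean => // w; apply: le_trans (TQ w); exact: ler_norm.
  rewrite -mulN1r -meanZ ?bounded_rv_Lfun1//.
  apply: ler_mean => //; first by apply: bounded_rvM => //; exact: bounded_rv_cst.
  by move=> w; rewrite mulN1r; have := TQ w; rewrite ler_norml => /andP[].
apply: (le_trans (ler_norm _)); rewrite normrM.
apply: (le_trans (ler_wpM2l (normr_ge0 _) mT)).
rewrite normrM normfV [`|2 * c|]gtr0_norm ?mulr_gt0//.
have -> : `|gamma| / (2 * c) * (C * \sum_i mean P (fun w => dev w i 0 ^+ 2)) =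
  (`|gamma| * \sum_i mean P (fun w => dev w i 0 ^+ 2)) * (2 * enorm e * `|L2| * c ^+ 2).
  by rewrite /C; field; rewrite gt_eqF.
have -> : enorm e * (2 * n%:R * c ^+ 2 * `|L2|) = n%:R * (2 * enorm e * `|L2| * c ^+ 2) by ring.
by rewrite ler_wpM2r ?mean_sqr_dev_le// !mulr_ge0 ?enorm_ge0 ?(ltW c_gt0).
Qed.

(** The map [a] stands for either evaluation point. Once the perturbation is fixed, [dev w i 0] is a
    constant factor: it preserves centering and multiplies the second moment by its square. *)
Lemma noise_term (V : {RV P >-> Xi}) (a : borel_cV R n -> borel_cV R n) i :
  same_law V xi -> measurable_fun setT a ->
  (forall A B, measurable A -> measurable B ->
    P (D @^-1` A `&` V @^-1` B) = P (D @^-1` A) * P (V @^-1` B))%E ->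
  let N w := dev w i 0 * noise zeta Z (a (D w), V w) in
  [/\ N \in Lfun P 2%:E, mean P N = 0 &
      mean P (fun w => N w ^+ 2) <= sigma ^+ 2 * mean P (fun w => dev w i 0 ^+ 2)].
Proof.
move=> lawV ma indDV N.
have mN := measurable_noise zeta_meas Z_lip.
pose h (t : borel_cV R n) := (t : 'cV[R]_n) i 0 - p i 0.
have mh : measurable_fun setT h by apply: measurable_funB => //; exact: measurable_coord.
pose G (z : borel_cV R n * Xi) := h z.1 * noise zeta Z (a z.1, z.2).
have hD w : h (D w) = dev w i 0 by rewrite /h /dev !mxE.
have GN : (fun w => G (D w, V w)) = N by apply/funext => w; rewrite /G/= hD.
have mG : measurable_fun setT G.
  apply: measurable_funM; first exact: (measurableT_comp mh measurable_fst).
  apply: (measurableT_comp mN); apply: measurable_fun_pair; last exact: measurable_snd.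
  exact: (measurableT_comp ma measurable_fst).
have mNt t : measurable_fun setT (fun x => noise zeta Z (t, x)).
  exact: (measurable_fun_pair2 _ mN).
have iNt t : (distribution P V).-integrable setT (fun x => (noise zeta Z (t, x))%:E).
  apply/Lfun1_integrable; apply: Lfun2_Lfun1; apply: Lfun2P => //.
  apply: (le_lt_trans (noise_centered zeta_meas Z_lip unbiased var_le lawV t).2).
  by rewrite ltry.
pose s t := sigma ^+ 2 * h t ^+ 2.
have bs : bounded_rv (s \o D).
  apply: bounded_rvM; first exact: bounded_rv_cst.
  by under eq_fun do rewrite hD; exact: bounded_rv_dev_sqr.
have [||||L2N EN N2] := @conditionally_centered _ _ _ P _ _ _ _ D V indDV G s mG.
- by apply: measurable_funM => //; exact: measurable_funX.
- move=> t; rewrite /G/=; under eq_integral do rewrite EFinM.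
  rewrite integralZl//.
  by rewrite (noise_centered zeta_meas Z_lip unbiased var_le lawV (a t)).1 mule0.
- move=> t; rewrite /G/=; under eq_integral do rewrite exprMn EFinM.
  rewrite ge0_integralZl//; last 3 first.
  + by apply/measurable_EFinP; exact: measurable_funX.
  + by move=> x _; rewrite lee_fin sqr_ge0.
  + by rewrite lee_fin sqr_ge0.
  rewrite /s (mulrC (sigma ^+ 2)) [X in (_ <= X)%E]EFinM.
  apply: lee_wpmul2l; first by rewrite lee_fin sqr_ge0.
  exact: (noise_centered zeta_meas Z_lip unbiased var_le lawV (a t)).2.
- have := bounded_rv_Lfun1 P bs => /Lfun1_integrable/integrable_lty.
  exact.
rewrite GN in L2N EN.
split => //; first by rewrite /mean EN.
rewrite -meanZ; last exact/bounded_rv_Lfun1/bounded_rv_dev_sqr.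
have -> : (fun w => sigma ^+ 2 * dev w i 0 ^+ 2) = s \o D.
  by apply/funext => w; rewrite /s/= hD.
have N2E : (fun w => G (D w, V w) ^+ 2) = (fun w => N w ^+ 2).
  by apply/funext => w; rewrite -GN.
have N21 : (fun w => N w ^+ 2) \in Lfun P 1.
  by apply/Lfun1_integrable; exact: (Lfun2_integrable_sqr L2N).
rewrite -lee_fin -(EFin_mean N21) -(EFin_mean (bounded_rv_Lfun1 P bs)).
by rewrite -N2E.
Qed.

Variables (V1 V2 : {RV P >-> Xi}).
Hypothesis V1_law : same_law V1 xi.
Hypothesis V2_law : same_law V2 xi.
Hypothesis D_V1 : forall A B, measurable A -> measurable B ->
  (P (D @^-1` A `&` V1 @^-1` B) = P (D @^-1` A) * P (V1 @^-1` B))%E.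
Hypothesis D_V2 : forall A B, measurable A -> measurable B ->
  (P (D @^-1` A `&` V2 @^-1` B) = P (D @^-1` A) * P (V2 @^-1` B))%E.

Definition sample i w : R :=
  (zeta (V1 w) (plus_point c p (D w)) - zeta (V2 w) (minus_point c p (D w))) / (2 * c)
    * (gamma * dev w i 0).

(** The summand is gamma / (2c) times two centered noise terms plus the noiseless difference. From
    (x - y + z)^2 <= 3(x^2 + y^2 + z^2) come 6 = 3 * 2 for the two noises and 24 = 3 * 8 for the
    difference. The factor [dev w i 0 ^+ 2] is kept, so that summing over i later produces
    E|Delta|^2. *)
Lemma sample_moments i :
  [/\ sample i \in Lfun P 2%:E,
      mean P (sample i) = gamma / (2 * c) * mean P (fun w => dev w i 0 * sym_diff w) &
      mean P (fun w => sample i w ^+ 2) <= (gamma / (2 * c)) ^+ 2 *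
        (6 * sigma ^+ 2 + 24 * c ^+ 2 * M ^+ 2) * mean P (fun w => dev w i 0 ^+ 2)].
Proof.
have [L1N EN1 N12] := noise_term i V1_law measurable_plus_point D_V1.
have [L2N EN2 N22] := noise_term i V2_law measurable_minus_point D_V2.
set N1 := (fun w => _) in L1N EN1; set N2 := (fun w => _) in L2N EN2.
pose B w := dev w i 0 * sym_diff w.
have bB : bounded_rv B := bounded_rv_dev_sym_diff i.
have bd := bounded_rv_dev_sqr i.
pose k := gamma / (2 * c).
have sE : sample i = fun w => k * (N1 w + (-1 * N2 w + B w)).
  apply/funext => w; rewrite /sample /N1 /N2 /B /noise /sym_diff/=.
  by rewrite !zeta_extE// !Z_extE// /k; field; rewrite gt_eqF.
have LB := bounded_rv_Lfun2 P bB.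
have LM2 (a : R) X : X \in Lfun P 2%:E -> (fun w => a * X w) \in Lfun P 2%:E.
  move=> X2; rewrite (_ : (fun w => _) = a \o* X).
    by apply: Lfun_scale => //; rewrite ler1n.
  by apply/funext => w /=; rewrite mulrC.
have h12 : (1 <= 2%:E :> \bar R)%E by rewrite lee1n.
have LD2 X Y : X \in Lfun P 2%:E -> Y \in Lfun P 2%:E -> (fun w => X w + Y w) \in Lfun P 2%:E.
  by move=> X2 Y2; apply: rpredD.
have LS : (fun w => N1 w + (-1 * N2 w + B w)) \in Lfun P 2%:E.
  by apply: (@LD2) => //; apply: (@LD2) => //; exact: LM2.
split.
- by rewrite sE; exact: LM2.
- rewrite sE meanZ; last exact: Lfun2_Lfun1.
  rewrite meanD; [|exact: Lfun2_Lfun1|by apply: Lfun2_Lfun1; apply: (@LD2) => //; exact: LM2].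
  rewrite meanD; [|by apply: Lfun2_Lfun1; exact: LM2|exact: Lfun2_Lfun1].
  by rewrite meanZ ?EN1 ?EN2 ?mulr0 ?add0r//; exact: Lfun2_Lfun1.
have sq1 X : X \in Lfun P 2%:E -> (fun w => X w ^+ 2) \in Lfun P 1.
  by move=> X2; exact/Lfun1_integrable/(Lfun2_integrable_sqr X2).
(* The 8 is the square of 2 M c |Delta| with |Delta|^2 <= 2. *)
pose bd2 w := 8 * c ^+ 2 * M ^+ 2 * dev w i 0 ^+ 2.
have LZ1 (a : R) X : X \in Lfun P 1 -> (fun w => a * X w) \in Lfun P 1.
  move=> X2; rewrite (_ : (fun w => _) = a \o* X).
    by apply: Lfun_scale.
  by apply/funext => w /=; rewrite mulrC.
have LD1 X Y : X \in Lfun P 1 -> Y \in Lfun P 1 -> (fun w => X w + Y w) \in Lfun P 1.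
  by move=> X2 Y2; apply: rpredD.
have Ld := bounded_rv_Lfun1 P bd.
have key w : sample i w ^+ 2 <= k ^+ 2 * 3 * (N1 w ^+ 2 + (N2 w ^+ 2 + bd2 w)).
  rewrite sE exprMn -mulrA ler_wpM2l ?sqr_ge0//.
  have : B w ^+ 2 <= bd2 w.
    rewrite /B exprMn mulrC /bd2 ler_wpM2r ?sqr_ge0//.
    have := sym_diff_bound w; have := simplex_sqr_dist_le2 (D_simplex w) p_simplex.
    rewrite -/(dev w) => d2 sd.
    rewrite -real_normK ?num_real//.
    apply: (@le_trans _ _ ((2 * M * (c * enorm (dev w))) ^+ 2)).
      by rewrite ler_pXn2r// nnegrE// !mulr_ge0 ?M_ge0 ?enorm_ge0 ?(ltW c_gt0).
    rewrite (_ : _ ^+ 2 = 4 * c ^+ 2 * M ^+ 2 * enorm (dev w) ^+ 2); last by ring.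
    rewrite (_ : 8 * c ^+ 2 * M ^+ 2 = 4 * c ^+ 2 * M ^+ 2 * 2); last by ring.
    by rewrite ler_wpM2l// mulr_ge0 ?sqr_ge0// mulr_ge0 ?sqr_ge0.
  (* These three squares add up to exactly the gap 3(x^2 + y^2 + z^2) - (x - y + z)^2. *)
  have := sqr_ge0 (N1 w + N2 w); have := sqr_ge0 (N1 w - B w); have := sqr_ge0 (N2 w + B w).
  by nra.
have LR : (fun w => N2 w ^+ 2 + bd2 w) \in Lfun P 1.
  by apply: (@LD1); [exact: sq1|exact: LZ1].
apply: (@le_trans _ _ (mean P (fun w => k ^+ 2 * 3 * (N1 w ^+ 2 + (N2 w ^+ 2 + bd2 w))))).
  rewrite /mean expectation.unlock; apply: (@le_Rintegral _ _ _ P) => //.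
    by apply/Lfun1_integrable/sq1; rewrite sE; exact: LM2.
  by apply/Lfun1_integrable/LZ1/LD1 => //; exact: sq1.
rewrite meanZ; last by apply: (@LD1) => //; exact: sq1.
rewrite meanD//; last exact: sq1.
rewrite meanD; [|exact: sq1|exact: LZ1].
rewrite /bd2 meanZ// -/k -[X in X <= _]mulrA -[X in _ <= X]mulrA.
apply: ler_wpM2l; first exact: sqr_ge0.
have N12' : mean P (fun w => N1 w ^+ 2) <= sigma ^+ 2 * mean P (fun w => dev w i 0 ^+ 2) := N12.
have N22' : mean P (fun w => N2 w ^+ 2) <= sigma ^+ 2 * mean P (fun w => dev w i 0 ^+ 2) := N22.
set m1 := mean P (fun w => N1 w ^+ 2) in N12' *.
set m2 := mean P (fun w => N2 w ^+ 2) in N22' *.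
set m := mean P (fun w => dev w i 0 ^+ 2) in N12' N22' *.
lra.
Qed.

End Sample.

(** * The estimator *)

(** The supremum is a genuine upper bound because the gradient norms are bounded: compare with the
    fixed point [q], the simplex having diameter at most 2. *)
Lemma grad_le_sup (R : realType) (n : nat) (Z : 'cV[R]_n -> R) (L1 : R) (q : 'cV[R]_n) :
  simplex_lipschitz enorm (grad Z) L1 -> simplex q ->
  enorm (grad Z q) <= sup [set enorm (grad Z q) | q in simplex].
Proof.
move=> gL sq; apply: ub_le_sup; last by exists q.
exists (enorm (grad Z q) + `|L1| * 2) => _ [r sr <-].
rewrite -[X in enorm X](subrK (grad Z q)) addrC (le_trans (enormD _ _))// lerD2l.
apply: (le_trans (gL _ _ sr sq)); apply: (@le_trans _ _ (`|L1| * enorm (r - q))).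
  by rewrite ler_wpM2r ?enorm_ge0// ler_norm.
rewrite ler_wpM2l//; have := simplex_sqr_dist_le2 sr sq.
by have := enorm_ge0 (r - q); nra.
Qed.

Lemma enorm_sum_le (R : realType) (n : nat) (I : Type) (r : seq I) (F : I -> 'cV[R]_n) :
  enorm (\sum_(i <- r) F i) <= \sum_(i <- r) enorm (F i).
Proof.
elim: r => [|i r IH]; first by rewrite !big_nil enorm0.
by rewrite !big_cons (le_trans (enormD _ _))// lerD2l.
Qed.

Lemma mean_same_law (d d' : measure_display) (Omega : measurableType d)
    (T : measurableType d') (R : realType) (P : probability Omega R)
    (X Y : {RV P >-> T}) (f : T -> R) :
  measurable_fun setT f -> same_law X Y ->
  bounded_rv (f \o X) -> bounded_rv (f \o Y) -> mean P (f \o X) = mean P (f \o Y).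
Proof.
move=> mf XY bX bY.
have mEf : measurable_fun setT (EFin \o f) by exact/measurable_EFinP.
have E (W : {RV P >-> T}) : bounded_rv (f \o W) ->
    mean P (f \o W) = fine (\int[distribution P W]_t (EFin \o f) t)%E.
  move=> bW; rewrite integral_distribution//; last first.
    exact/Lfun1_integrable/bounded_rv_Lfun1.
  by rewrite /mean expectation.unlock.
rewrite !E//; congr fine; apply: eq_measure_integral => A mA _; exact: XY.
Qed.

Lemma variance_le_mean_sqr (d : measure_display) (Omega : measurableType d) (R : realType)
    (P : probability Omega R) (X : Omega -> R) : X \in Lfun P 2%:E ->
  ('V_P[X] <= (mean P (fun w => X w ^+ 2))%:E)%E.
Proof.
move=> X2; have X1 := Lfun2_Lfun1 X2.
have X21 : (fun w => X w ^+ 2) \in Lfun P 1.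
  by apply/Lfun1_integrable; exact: (Lfun2_integrable_sqr X2).
rewrite varianceE// -EFin_mean// (EFin_mean X1).
have -> : (X ^+ 2 = fun w => X w ^+ 2) by apply/funext => w; rewrite !expr2.
by rewrite EFin_mean// lee_fin lerBlDr lerDl sqr_ge0.
Qed.

(** * Independence between summands *)

Section BlockSample.
Context {R : realType} {n N : nat}.
Context {d : measure_display} {Omega : measurableType d} (P : probability Omega R).
Context {d' : measure_display} {Xi : measurableType d'}.
Variables (zeta : Xi -> 'cV[R]_n -> R).
Hypothesis zeta_meas : measurable_fun (setT `*` (simplex : set (borel_cV R n)))
  (fun xq : Xi * borel_cV R n => zeta xq.1 xq.2).
Variables (p : 'cV[R]_n) (c gamma : R).
Variables (deltas : 'I_N -> {RV P >-> borel_cV R n}) (xis : 'I_(2 * N) -> {RV P >-> Xi}).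
Hypothesis plus_simplex : forall j w, simplex (plus_point c p (deltas j w)).
Hypothesis minus_simplex : forall j w, simplex (minus_point c p (deltas j w)).

Definition source_sigma (s : 'I_N + 'I_(2 * N)) : set (set Omega) :=
  match s with inl j => sigma_RV (deltas j) | inr k => sigma_RV (xis k) end.

Hypothesis indep : mutually_independent P source_sigma.

Lemma source_sigma_measurable s : source_sigma s `<=` measurable.
Proof.
by case: s => [j|k] _ [A mA <-]; rewrite setTI -[X in measurable X]setTI;
  exact: measurable_funPT.
Qed.

Lemma source_sigma_setI s : setI_closed (source_sigma s).
Proof.
by case: s => [j|k] _ _ [A mA <-] [B mB <-]; exists (A `&` B);
  [exact: measurableI|rewrite !setTI|exact: measurableI|rewrite !setTI].
Qed.

Lemma source_sigma_setT s : source_sigma s setT.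
Proof. by case: s => [j|k]; exists setT => //; rewrite setTI. Qed.

Let indep_source (J K : {set 'I_N + 'I_(2 * N)}) :
  (forall s, s \in J -> s \notin K) ->
  indep_sets P <<s block source_sigma J >> <<s block source_sigma K >>.
Proof.
apply: indep_blocks indep; [exact: source_sigma_measurable|exact: source_sigma_setI|].
exact: source_sigma_setT.
Qed.

Lemma indep_delta_xi j k A B : measurable A -> measurable B ->
  (P (deltas j @^-1` A `&` xis k @^-1` B) =
   P (deltas j @^-1` A) * P (xis k @^-1` B))%E.
Proof.
move=> mA mB.
have mD : measurable_fun setT (deltas j : g_sigma_algebraType
    (block source_sigma [set inl j]%SET) -> borel_cV R n).
  by apply: (measurable_fun_block (i := inl j) source_sigma_setT) => //; rewrite inE.
have mV : measurable_fun setT (xis k : g_sigma_algebraType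
    (block source_sigma [set inr k]%SET) -> Xi).
  by apply: (measurable_fun_block (i := inr k) source_sigma_setT) => //; rewrite inE.
apply: (@indep_source [set inl j]%SET [set inr k]%SET).
- by move=> s; rewrite !inE => /eqP ->.
- by rewrite -[X in _ X]setTI; exact: mD.
- by rewrite -[X in _ X]setTI; exact: mV.
Qed.

Definition sample_at j := sample zeta p c gamma (deltas j) (xis (fst_eval j)) (xis (snd_eval j)).

Definition sources j : {set 'I_N + 'I_(2 * N)} :=
  [set inl j; inr (fst_eval j); inr (snd_eval j)]%SET.

(** Evaluations of equal parity differ because doubling is injective; those of opposite parity can
    never coincide. *)
Lemma sources_disjoint j k : j != k -> forall s, s \in sources j -> s \notin sources k.
Proof.
move=> jk s; rewrite !inE => /orP[/orP[]|] /eqP ->; rewrite /= ?orbF.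
- by apply: contraNN jk => /eqP [->].
- apply/negP => /orP[] /eqP [] /eqP.
    by rewrite eqn_mul2l/= => /eqP/val_inj/eqP; rewrite (negbTE jk).
  by move=> /eqP/(congr1 odd); rewrite !mul2n ?oddS !odd_double.
- apply/negP => /orP[] /eqP [] /eqP.
    by move=> /eqP/(congr1 odd); rewrite !mul2n ?oddS !odd_double.
  by rewrite eqn_mul2l/= => /eqP/val_inj/eqP; rewrite (negbTE jk).
Qed.

Lemma measurable_sample_at j i : measurable_fun setT
  (sample_at j i : g_sigma_algebraType (block source_sigma (sources j)) -> R).
Proof.
pose T := g_sigma_algebraType (block source_sigma (sources j)).
have mD : measurable_fun setT (deltas j : T -> borel_cV R n).
  by apply: (measurable_fun_block (i := inl j) source_sigma_setT) => //; rewrite !inE eqxx.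
have mV1 : measurable_fun setT (xis (fst_eval j) : T -> Xi).
  apply: (measurable_fun_block (i := inr (fst_eval j)) source_sigma_setT) => //.
  by rewrite !inE eqxx orbT.
have mV2 : measurable_fun setT (xis (snd_eval j) : T -> Xi).
  apply: (measurable_fun_block (i := inr (snd_eval j)) source_sigma_setT) => //.
  by rewrite !inE eqxx !orbT.
(* In terms of [zeta_ext] the summand is a composite of maps measurable on whole spaces. *)
have -> : sample_at j i = fun w : T =>
    (zeta_ext zeta (xis (fst_eval j) w, plus_point c p (deltas j w))
     - zeta_ext zeta (xis (snd_eval j) w, minus_point c p (deltas j w))) * (2 * c)^-1
    * (gamma * ((deltas j w : 'cV[R]_n) i 0 - p i 0)).
  by apply/funext => w; rewrite /sample_at /sample !zeta_extE// !mxE.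
have mz := measurable_zeta_ext zeta_meas.
apply: measurable_funM.
  apply: measurable_funM => //; apply: measurable_funB; apply: (measurableT_comp mz);
    apply: measurable_fun_pair => //; apply: (measurableT_comp _ mD).
    exact: measurable_plus_point.
  exact: measurable_minus_point.
apply: measurable_funM => //; apply: measurable_funB => //.
exact: (measurableT_comp (measurable_coord i) mD).
Qed.

Lemma sample_at_indep j k i A B : j != k -> measurable A -> measurable B ->
  (P (sample_at j i @^-1` A `&` sample_at k i @^-1` B) =
   P (sample_at j i @^-1` A) * P (sample_at k i @^-1` B))%E.
Proof.
move=> jk mA mB; apply: (@indep_source _ _ (sources_disjoint jk)).
- by rewrite -[X in _ X]setTI; have := @measurable_sample_at j i measurableT A mA.
- by rewrite -[X in _ X]setTI; have := @measurable_sample_at k i measurableT B mB.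
Qed.

End BlockSample.

Theorem theorem4 (R : realType) :
  exists K : R, 0 < K /\
  forall (n : nat) (Z : 'cV[R]_n -> R) (L0 L1 L2 : R)
    (Z_C2 : simplex_C2 Z)
    (Z_lip : simplex_lipschitz Num.norm Z L0)
    (grad_lip : simplex_lipschitz enorm (grad Z) L1)
    (hess_lip : simplex_lipschitz spectral_norm (hess Z) L2)
    (d : measure_display) (Omega : measurableType d) (P : probability Omega R)
    (d' : measure_display) (Xi : measurableType d')
    (zeta : Xi -> 'cV[R]_n -> R)
    (zeta_meas : measurable_fun (setT `*` (simplex : set (borel_cV R n)))
       (fun xq : Xi * borel_cV R n => zeta xq.1 xq.2))
    (xi : {RV P >-> Xi}) (sigma : R)
    (sigma_gt0 : 0 < sigma)
    (unbiased : forall q, simplex q ->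
       ('E_P[fun w => zeta (xi w) q] = (Z q)%:E)%E)
    (var_le : forall q, simplex q ->
       ('V_P[fun w => zeta (xi w) q] <= (sigma ^+ 2)%:E)%E)
    (p : 'cV[R]_n) (p_simplex : simplex p)
    (c : R) (c_gt0 : 0 < c) (gamma : R)
    (delta : {RV P >-> borel_cV R n})
    (delta_simplex : forall w, simplex (delta w))
    (MC1 : expectation_mx P (fun w => perturbation gamma p (delta w)) = 0)
    (MC2 : exists lambda : R,
       expectation_mx P
         (fun w => ((delta w : 'cV[R]_n) - p) *m (perturbation gamma p (delta w))^T)
       = 1%:M - lambda *: (ones *m ones^T))
    (N : nat) (N_gt0 : (0 < N)%N)
    (deltas : 'I_N -> {RV P >-> borel_cV R n})
    (deltas_simplex : forall j w, simplex (deltas j w))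
    (plus_simplex : forall j w, simplex (plus_point c p (deltas j w)))
    (minus_simplex : forall j w, simplex (minus_point c p (deltas j w)))
    (xis : 'I_(2 * N) -> {RV P >-> Xi})
    (deltas_law : forall j, same_law (deltas j) delta)
    (xis_law : forall k, same_law (xis k) xi)
    (indep : mutually_independent P
       (fun s : 'I_N + 'I_(2 * N) =>
          match s with
          | inl j => sigma_RV (deltas j)
          | inr k => sigma_RV (xis k)
          end)),
  let M1 := sup [set enorm (grad Z q) | q in simplex] in
  let psihat := psi_hat c gamma p deltas (fun k w => zeta (xis k w)) in
  let psi := expectation_mx P psihat in
  let eps0 := - dotv (grad Z p) ones / n%:R in
  let eps := psi - grad Z p - eps0 *: ones in
  enorm eps <= K * `|n%:R * c ^+ 2 * L2| /\
  ('E_P[fun w => (enorm (psihat w - psi) ^+ 2)%R] <=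
   (K * `|gamma * n%:R / (N%:R * c ^+ 2)
          * (sigma ^+ 2 + c ^+ 2 * M1 ^+ 2 + c ^+ 4 * L1 ^+ 2)|)%:E)%E.
Proof.
(* The bias needs only 2. The variance needs 6 = 24 / 4, the 24 being that of [sample_moments] and
   the 4 coming from (2c)^2. *)
exists 6; split => // n Z L0 L1 L2 Z_C2 Z_lip grad_lip hess_lip d Omega P d' Xi zeta
  zeta_meas xi sigma sigma_gt0 unbiased var_le p p_simplex c c_gt0 gamma delta
  delta_simplex _ [lambda MC2] N N_gt0 deltas deltas_simplex plus_simplex minus_simplex
  xis deltas_law xis_law indep M1 psihat psi eps0 eps.
have grad_le q : simplex q -> enorm (grad Z q) <= M1 by exact: grad_le_sup grad_lip.
pose X := sample_at zeta p c gamma deltas xis.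
have {}indep : mutually_independent P (source_sigma deltas xis) by exact: indep.
pose m j i := mean P (fun w => dev p (deltas j) w i 0 ^+ 2).
(* (MC2) concerns [delta]; its entries are means of bounded functions, so equality of laws transfers
   them to each [deltas j]. *)
have moment2 j i k :
    gamma * mean P (fun w => dev p (deltas j) w i 0 * dev p (deltas j) w k 0) =
    (i == k)%:R - lambda.
  have := congr1 (fun A : 'M[R]_n => A i k) MC2.
  rewrite !mxE big_ord1 !mxE mulr1 mulr1 => <-.
  pose f (t : borel_cV R n) := ((t : 'cV[R]_n) i 0 - p i 0) * ((t : 'cV[R]_n) k 0 - p k 0).
  have mf : measurable_fun setT f.
    by apply: measurable_funM; apply: measurable_funB => //; exact: measurable_coord.
  have fE (W : {RV P >-> borel_cV R n}) : (fun w => dev p W w i 0 * dev p W w k 0) = f \o W.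
    by apply/funext => w; rewrite /f/= /dev !mxE.
  have bf (W : {RV P >-> borel_cV R n}) : (forall w, simplex (W w)) -> bounded_rv (f \o W).
    by move=> sW; rewrite -fE; apply: bounded_rvM; exact: bounded_rv_dev.
  rewrite fE (mean_same_law mf (deltas_law j)); [|exact: bf|exact: bf].
  rewrite -meanZ; last exact/bounded_rv_Lfun1/bf.
  congr (mean P _); apply/funext => w.
  by rewrite /f/= /perturbation !mxE big_ord1 !mxE; ring.
have momX j i := sample_moments zeta_meas Z_C2 Z_lip grad_le unbiased var_le gamma
  p_simplex c_gt0 (deltas_simplex j) (plus_simplex j) (minus_simplex j)
  (xis_law (fst_eval j)) (xis_law (snd_eval j))
  (fun A B => @indep_delta_xi _ _ _ _ _ _ _ _ _ _ indep j (fst_eval j) A B)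
  (fun A B => @indep_delta_xi _ _ _ _ _ _ _ _ _ _ indep j (snd_eval j) A B) i.
have X2 j i : X j i \in Lfun P 2%:E by have [] := momX j i.
have psihatE i : (fun w => psihat w i 0) = N%:R^-1 \o* (\sum_j X j i).
  apply/funext => w; rewrite /psihat /psi_hat !mxE summxE mulrC fct_sumE.
  by congr (_ * _); apply: eq_bigr => j _; rewrite /X /sample_at /sample /dev !mxE.
have h12 : (1 <= 2%:E :> \bar R)%E by rewrite lee1n.
have SX2 i : \sum_j X j i \in Lfun P 2%:E by apply: rpred_sum => //.
have N0 : N%:R != 0 :> R by rewrite pnatr_eq0 -lt0n.
have psiE i : psi i 0 = N%:R^-1 * \sum_j mean P (X j i).
  rewrite /psi mxE -[LHS]/(mean P (fun w => psihat w i 0)) psihatE.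
  rewrite (_ : _ \o* _ = fun w => N%:R^-1 * (\sum_j X j i) w); last first.
    by apply/funext => w /=; rewrite mulrC.
  rewrite meanZ; last exact: Lfun2_Lfun1.
  rewrite -mean_sum; last by move=> j; exact: Lfun2_Lfun1.
  by congr (_ * mean P _); apply/funext => w; rewrite fct_sumE.
have lamE j : lambda = n%:R^-1 := lambdaE p_simplex (deltas_simplex j) (moment2 j).
split.
  have errE j i : sample_mean_error Z p c gamma lambda (deltas j) i 0 =
      mean P (X j i) - (grad Z p i 0 + eps0).
    have [_ -> _] := momX j i.
    rewrite !mxE (lamE j) /eps0 dotvE.
    under [in RHS]eq_bigr do rewrite [ones _ _]mxE mulr1.
    by ring.
  (* The total bias is the average of the bias vectors of the summands, so the triangle inequality
     reduces it to one of them. *)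
  have -> : eps = N%:R^-1 *: \sum_j sample_mean_error Z p c gamma lambda (deltas j).
    apply/matrixP => i k; rewrite ord1 [RHS]mxE summxE.
    under eq_bigr do rewrite errE.
    rewrite sumrB sumr_const card_ord -[(_ + _) *+ N]mulr_natl mulrBr mulKf// -psiE.
    by rewrite /eps !mxE mulr1 opprD addrA.
  rewrite enormZ ger0_norm ?invr_ge0//.
  rewrite -ler_pdivlMl ?invr_gt0 ?ltr0n// invrK.
  apply: (le_trans (enorm_sum_le _ _)).
  apply: (@le_trans _ _ (\sum_(j < N) 2 * n%:R * c ^+ 2 * `|L2|)).
    apply: ler_sum => j _.
    exact: (sample_mean_error_le Z_C2 Z_lip hess_lip grad_le p_simplex c_gt0
      (deltas_simplex j) (plus_simplex j) (minus_simplex j) (moment2 j)).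
  rewrite sumr_const card_ord -[(_ * _) *+ N]mulr_natl ler_wpM2l//.
  have nc0 : 0 <= n%:R * c ^+ 2 :> R by rewrite mulr_ge0 ?ler0n ?sqr_ge0.
  rewrite normrM ger0_norm//.
  have -> : 2 * n%:R * c ^+ 2 * `|L2| = 2 * (n%:R * c ^+ 2 * `|L2|) by rewrite !mulrA.
  have h26 : 2 <= 6 :> R by rewrite ler_nat.
  by rewrite ler_wpM2r ?(mulr_ge0 nc0)//.
pose B := (gamma / (2 * c)) ^+ 2 * (6 * sigma ^+ 2 + 24 * c ^+ 2 * M1 ^+ 2).
(* Splitting the squared norm into scalar variances means that summands have to be uncorrelated only
   within the same coordinate. *)
have sqE : ('E_P[fun w => (enorm (psihat w - psi) ^+ 2)%R] =
    \sum_(i < n) 'V_P[fun w => psihat w i 0%R])%E.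
  rewrite expectation.unlock.
  under eq_integral do rewrite sqr_enorm -sumEFin.
  rewrite ge0_integral_sum//.
  - apply: eq_bigr => i _; rewrite /variance covariance.unlock expectation.unlock.
    apply: eq_integral => w _; congr EFin.
    have pE : psi i 0 = fine (\int[P]_w (psihat w i 0)%:E)%E.
      by rewrite /psi mxE expectation.unlock.
    by rewrite mxE [(- psi) i 0]mxE pE expr2.
  - move=> i; apply/measurable_EFinP; apply: measurable_funX.
    rewrite (_ : (fun w => _) = (fun w => psihat w i 0 - psi i 0)); last first.
      by apply/funext => w; rewrite mxE [(- psi) i 0]mxE.
    apply: measurable_funB => //; rewrite psihatE; apply: measurable_funM => //.
    by have := SX2 i => /andP[]; rewrite inE.
  - by move=> i w _; rewrite lee_fin sqr_ge0.
have varE i : ('V_P[fun w => psihat w i 0%R] <=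
    ((N%:R^-1) ^+ 2 * \sum_j B * m j i)%:E)%E.
  rewrite psihatE varianceZ// variance_sum_uncorrelated ?index_enum_uniq//; last first.
    move=> j k jk; apply: indep_covariance0 => // A C mA mC.
    exact: sample_at_indep.
  rewrite [X in (_ <= X)%E]EFinM; apply: lee_wpmul2l; first by rewrite lee_fin sqr_ge0.
  rewrite -sumEFin; apply: lee_sum => j _.
  apply: (le_trans (variance_le_mean_sqr (X2 j i))).
  by rewrite lee_fin; have [] := momX j i.
rewrite sqE; apply: (@le_trans _ _ (\sum_(i < n) ((N%:R^-1) ^+ 2 * \sum_j B * m j i)%:E)%E).
  by apply: lee_sum.
rewrite sumEFin lee_fin -mulr_sumr exchange_big/=.
(* One of the two factors |gamma| in [B] is set aside, to be absorbed with E|Delta|^2 into n by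
   [mean_sqr_dev_le]. *)
pose b := `|gamma| / (4 * c ^+ 2) * (6 * sigma ^+ 2 + 24 * c ^+ 2 * M1 ^+ 2).
have cM0 : 0 <= c ^+ 2 * M1 ^+ 2 by rewrite mulr_ge0 ?sqr_ge0.
have cL0 : 0 <= c ^+ 4 * L1 ^+ 2.
  by apply: mulr_ge0 (sqr_ge0 _); rewrite exprn_ge0 ?(ltW c_gt0).
have q0 : 0 <= 6 * sigma ^+ 2 + 24 * c ^+ 2 * M1 ^+ 2.
  apply: addr_ge0; first by apply: mulr_ge0 (sqr_ge0 _); rewrite ler0n.
  by rewrite -mulrA; apply: mulr_ge0 cM0; rewrite ler0n.
have b0 : 0 <= b.
  by apply: mulr_ge0 => //; apply: mulr_ge0 => //; rewrite invr_ge0 mulr_ge0 ?sqr_ge0.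
have BE : B = b * `|gamma|.
  rewrite /B /b exprMn -(real_normK (num_real gamma)).
  by field; rewrite gt_eqF.
apply: (@le_trans _ _ ((N%:R^-1) ^+ 2 * \sum_(j < N) b * n%:R)).
  apply: ler_wpM2l; first exact: sqr_ge0.
  apply: ler_sum => j _; rewrite -mulr_sumr BE -mulrA ler_wpM2l//.
  exact: (mean_sqr_dev_le p_simplex (deltas_simplex j) (moment2 j)).
rewrite sumr_const card_ord -[(_ * _) *+ N]mulr_natl normrM normrM normrM.
rewrite normfV ![`|_%:R|]ger0_norm// [`|N%:R * _|]ger0_norm ?mulr_ge0 ?(ltW c_gt0)//.
rewrite [`|sigma ^+ 2 + _ + _|]ger0_norm; last first.
  by apply: addr_ge0 => //; apply: addr_ge0 => //; exact: sqr_ge0.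
(* Here 3/2 = 6/4 and 6 = 24/4, while z stands for the nonnegative [L1] term. *)
have fin (x y z : R) : 0 <= x -> 0 <= y -> 0 <= z -> 3 / 2 * x + 6 * y <= 6 * (x + y + z).
  by clear; lra.
have -> : N%:R^-1 ^+ 2 * (N%:R * (b * n%:R)) =
    `|gamma| * n%:R / (N%:R * c ^+ 2) * (3 / 2 * sigma ^+ 2 + 6 * (c ^+ 2 * M1 ^+ 2)).
  by rewrite /b; field; rewrite N0 gt_eqF.
rewrite [X in _ <= X]mulrCA; apply: ler_wpM2l; last first.
  by apply: fin => //; exact: sqr_ge0.
by apply: divr_ge0; apply: mulr_ge0 => //; exact: sqr_ge0.

Qed.
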